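(* For every tree $T$ there exist $d>0$ and an integer $K$ such that the following holds. Let $G$ be a graph and let $\mathcal{B}$ be a blockade in $G$ of length at least $K$ and width $W$. If $G$ is $\frac{W}{d|G|}$-coherent, then there is a $\mathcal{B}$-rainbow copy of $T$ in $G$ (that is, a $\mathcal{B}$-rainbow induced subgraph of $G$ isomorphic to $T$).
   Context: All graphs are finite and simple; $|G|$ is the number of vertices. For $\epsilon>0$, $G$ is $\epsilon$-coherent if $|G|>1$, every vertex has degree less than $\epsilon|G|$, and there do not exist disjoint sets $A,B\subseteq V(G)$ with $|A|,|B|\ge\epsilon|G|$ and no edges between $A$ and $B$. A blockade in $G$ is a sequence $\mathcal{B}=(B_i:i\in I)$ of pairwise disjoint nonempty subsets of $V(G)$ (the blocks), where $I$ is a finite set of integers; its length is $|I|$ and its width is $\min_{i\in I}|B_i|$. An induced subgraph $H$ of $G$ is $\mathcal{B}$-rainbow if every vertex of $H$ belongs to some block of $\mathcal{B}$ and no two vertices of $H$ belong to the same block. *)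

(* Defs.v *)
From HB Require Import structures.
From mathcomp Require Import all_boot all_order all_algebra.
Set Implicit Arguments. Unset Strict Implicit. Unset Printing Implicit Defensive.
Import Order.TTheory GRing.Theory Num.Theory.

Definition simple_graph (V : finType) (e : rel V) : Prop :=
  symmetric e /\ irreflexive e.

Definition is_tree (U : finType) (e : rel U) : Prop :=
  [/\ simple_graph e,
      0 < #|U|,
      (forall x y : U, connect e x y) &
      (forall c : seq U, uniq c -> 3 <= size c -> ~~ cycle e c)].

Definition coherent (R : realFieldType) (V : finType) (e : rel V) (eps : R) : Prop :=
  [/\ 1 < #|V|,
      (forall v : V, (#|[set w | e v w]|%:R < eps * #|V|%:R)%R) &
      ~ (exists A B : {set V},
            [/\ [disjoint A & B],
                (eps * #|V|%:R <= #|A|%:R)%R,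
                (eps * #|V|%:R <= #|B|%:R)%R &
                (forall a b, a \in A -> b \in B -> ~~ e a b)])].

Definition blockade (V : finType) (n : nat) (B : 'I_n -> {set V}) : Prop :=
  (forall i, B i != set0) /\
  (forall i j, i != j -> [disjoint B i & B j]).

Definition is_width (V : finType) (n : nat) (B : 'I_n -> {set V}) (W : nat) : Prop :=
  (forall i, W <= #|B i|) /\ (exists i, #|B i| = W).

Definition rainbow_copy (U V : finType) (eT : rel U) (eG : rel V)
    (n : nat) (B : 'I_n -> {set V}) : Prop :=
  exists f : U -> V,
    [/\ injective f,
        (forall x y, eG (f x) (f y) = eT x y),
        (forall x, exists i, f x \in B i) &
        (forall x y i, f x \in B i -> f y \in B i -> x = y)].

(* Main.v *)
Require Import Defs.
From HB Require Import structures.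
From mathcomp Require Import all_boot all_order all_algebra.
From mathcomp Require Import zify.
From Stdlib Require Import Classical.
Import Order.TTheory GRing.Theory Num.Theory.
Set Implicit Arguments.
Unset Strict Implicit.

(* Replace the blocks by large subsets until passing to further large subsets
   destroys no rainbow copy of a subtree of [T], recording for each copy the
   label of the block of each vertex; by Ramsey's theorem we may also assume that
   whether a labelling is realized depends only on the order of the labels.

   Two realized labelled trees on disjoint label sets P and Q can often be joined
   by an edge xy: take copies of the first tree one after the other, so that the
   neighbours of their x-vertices fill up a part of the block of y, then find the
   second tree with y in that part and everything else among the vertices not
   adjacent to the chosen copies. This works when, at each step, the x-vertex sees
   many more of the remaining vertices than the rest of its copy does. Compare, for
   the labels in P, the median degrees into what remains of the blocks of Q. Either
   one label dominates many others, and joining is possible at that label, or many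
   labels have comparable medians; then some label y of Q can be attached as a leaf
   at any of these, by an averaging argument.

   In the second case T grows leaf by leaf. In the first case, with P placed
   between two halves of Q, the positions of x and y among the labels allow one to
   graft trees with an extremal root label onto trees with an extremal root label,
   in such a way that the new root label is extremal again; every rooted tree is
   obtained by such graftings. *)

(** * Ramsey's theorem *)

Lemma sum_pigeonhole (I : finType) (Q : {set I}) (F : I -> nat) (m : nat) :
  0 < #|Q| -> m <= \sum_(i in Q) F i -> exists2 i, i \in Q & m <= #|Q| * F i.
Proof.
move=> /card_gt0P[i0 Qi0] lem.
case: (arg_maxnP (P := mem Q) F Qi0) => i Qi maxi; exists i => //.
apply: leq_trans lem _; rewrite -sum_nat_const.
exact: leq_sum.
Qed.

Definition homogeneous (T : eqType) (C : Type) (col : seq T -> C) k (t : seq T) :=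
  forall a b, subseq a t -> subseq b t -> size a = k -> size b = k -> col a = col b.

(** The colour of a subsequence of length [k.+1] depends only on its first entry. *)
Fixpoint end_homogeneous (T : eqType) (C : Type) (col : seq T -> C) k (t : seq T) :=
  if t is x :: t' then
    homogeneous (fun a => col (x :: a)) k t' /\ end_homogeneous col k t'
  else True.

(** Each entry inherits the colour of the subsequences that start with it, and [fib c] collects the
    entries of colour [c]. *)
Lemma end_homogeneous_fibers (T : eqType) (C : finType) (col : seq T -> C) k t :
  end_homogeneous col k t ->
  exists fib : C -> seq T,
    [/\ forall c, subseq (fib c) t,
        forall c a, subseq a (fib c) -> size a = k.+1 -> col a = c &
        size t <= \sum_c size (fib c)].
Proof.
elim: t => [|x t IH] /=.
  by move=> _; exists (fun=> [::]); split=> //= c a /eqP->.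
case=> homx /IH[fib [sub homf szt]].
(* If fewer than [k] entries follow [x], no subsequence is to be coloured and [col [::]] is a mere
   default. *)
have [c0 c0P] : exists c0, forall a, subseq a t -> size a = k -> col (x :: a) = c0.
  have [ltk|lek] := ltnP (size t) k.
    by exists (col [::]) => a /size_subseq ? ?; lia.
  exists (col (x :: take k t)) => a sa za; apply: homx => //.
    exact: take_subseq.
  by rewrite size_take; case: ltngtP lek => // ->.
exists (fun c => if c == c0 then x :: fib c else fib c); split=> [c|c a|].
- case: eqP => _; first by rewrite /= eqxx.
  exact: subseq_trans (sub c) (subseq_cons _ _).
- case: eqP => [->|_]; last exact: homf.
  case: a => [//|y a] /=; case: eqP => [->|_] sa [za]; last by apply: homf => //=; rewrite za.
  apply: c0P => //; exact: subseq_trans sa (sub _).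
rewrite (bigD1 c0) //= eqxx /= addSn ltnS.
rewrite (bigD1 c0) //= in szt; apply: leq_trans szt _.
by rewrite leq_add2l; apply: leq_sum => c /negPf->.
Qed.

(** Repeatedly keep the first entry [x] and make the rest homogeneous for the colouring
    [a |-> col (x :: a)] of length [k]. The kept entries are end-homogeneous, and with [#|C| * m] of
    them some colour occurs [m] times. *)
Theorem ramsey k (C : finType) m :
  exists N, forall (T : eqType) (col : seq T -> C) (s : seq T), N <= size s ->
    exists t, [/\ subseq t s, size t = m & homogeneous col k t].
Proof.
elim: k m => [|k IH] m.
  exists m => T col s ms; exists (take m s); split=> [||a b _ _ /size0nil-> /size0nil->//].
    exact: take_subseq.
  by rewrite size_take; case: ltngtP ms => // ->.
have [N NP] : exists N, forall (T : eqType) (col : seq T -> C) (s : seq T),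
    N <= size s -> exists t, [/\ subseq t s, size t = #|C| * m & end_homogeneous col k t].
  elim: (_ * m) => [|n [N NP]].
    by exists 0 => T col s _; exists [::]; split=> //; apply: sub0seq.
  have [N' N'P] := IH N; exists N'.+1 => T col [//|x s] /= zs.
  have [t [ts zt homt]] := N'P T (fun a => col (x :: a)) s zs.
  have [t' [t't zt' eht']] := NP T col t (eq_leq (esym zt)).
  exists (x :: t'); split=> /=; [|by rewrite zt'|split=> //].
    by rewrite eqxx; apply: subseq_trans ts.
  by move=> a b sa sb; apply: homt; [apply: subseq_trans sa t't|apply: subseq_trans sb t't].
exists N => T col s /(NP _ col)[t [ts zt /end_homogeneous_fibers[fib [sub homf szt]]]].
have C0 : 0 < #|[set: C]| by apply/card_gt0P; exists (col [::]).
have [c _ cP] : exists2 c, c \in [set: C] & #|C| * m <= #|[set: C]| * size (fib c).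
  apply: (sum_pigeonhole C0); rewrite -zt; apply: leq_trans szt _.
  by apply: eq_leq; apply: eq_bigl => c; rewrite inE.
rewrite cardsT in C0 cP; rewrite leq_pmul2l // in cP.
exists (take m (fib c)); split.
- exact: subseq_trans (take_subseq _ _) (subseq_trans (sub c) ts).
- by rewrite size_take; case: ltngtP cP => // ->.
have aux a : subseq a (take m (fib c)) -> size a = k.+1 -> col a = c.
  by move=> sa; apply: homf; apply: subseq_trans sa (take_subseq _ _).
by move=> a b sa sb za zb; rewrite !aux.
Qed.

(** * Decompositions of trees *)

Section Trees.
Variables (U : finType) (eT : rel U).

Inductive leaf_built : {set U} -> Prop :=
| Leaf_root r : leaf_built [set r]
| Leaf_add X x w : leaf_built X -> x \in X -> w \notin X ->
    {in X, forall v, eT w v = (v == x)} -> leaf_built (w |: X).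

(** The shape that graftings produce: an edge always joins two roots, and the first of them remains
    the root. *)
Inductive rooted_tree : {set U} -> U -> Prop :=
| Rooted_single r : rooted_tree [set r] r
| Rooted_join X1 r X2 c : rooted_tree X1 r -> rooted_tree X2 c -> [disjoint X1 & X2] ->
    {in X1 & X2, forall u v, eT u v = (u == r) && (v == c)} ->
    rooted_tree (X1 :|: X2) r.

Lemma rooted_tree_root X r : rooted_tree X r -> r \in X.
Proof. by elim=> [s|X1 s X2 c _ sX1 _ _ _ _]; rewrite !inE ?sX1 ?eqxx. Qed.

Hypotheses (symT : symmetric eT) (irrT : irreflexive eT).

(** Descend through the joins to the single vertex [x], and join [w] to it there as a one-vertex
    tree. *)
Lemma rooted_tree_add X r x w : rooted_tree X r -> x \in X -> w \notin X ->
  {in X, forall v, eT w v = (v == x)} -> rooted_tree (w |: X) r.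
Proof.
move=> tX; elim: tX x w => {X r} [r|X1 r X2 c t1 IH1 t2 IH2 dis cross] x w.
  rewrite !inE => /eqP-> wr ew; rewrite setUC; apply: Rooted_join (Rooted_single _) _ _ _.
  - exact: Rooted_single w.
  - by rewrite disjoints1 !inE eq_sym.
  by move=> u v; rewrite !inE => /eqP-> /eqP->; rewrite symT ew ?inE ?eqxx.
rewrite !inE negb_or => xX /andP[w1 w2] ew.
have [rX1 cX2] := (rooted_tree_root t1, rooted_tree_root t2).
have neq12 u v : u \in X1 -> v \in X2 -> (u == v) = false.
  by move=> u1 v2; apply/eqP=> E; rewrite E (disjointFl dis v2) in u1.
have [x1|x1] := boolP (x \in X1).
  rewrite setUA; apply: Rooted_join (IH1 x w _ _ _) t2 _ _ => //.
  - by move=> v v1; rewrite ew // inE v1.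
  - by rewrite disjoints_subset subUset sub1set inE w2 -disjoints_subset.
  move=> u v; rewrite !inE => /orP[/eqP->|u1] v2; last exact: cross.
  rewrite ew ?inE ?v2 ?orbT // eq_sym neq12 //.
  by apply/esym/andP=> -[/eqP wr _]; rewrite wr rX1 in w1.
rewrite (negPf x1) /= in xX; rewrite setUCA.
apply: Rooted_join t1 (IH2 x w _ _ _) _ _ => //.
- by move=> v v2; rewrite ew // inE v2 orbT.
- by rewrite disjoint_sym disjoints_subset subUset sub1set inE w1 -disjoints_subset disjoint_sym.
move=> u v u1; rewrite !inE => /orP[/eqP->|v2]; last exact: cross.
rewrite symT ew ?inE ?u1 // neq12 //.
by apply/esym/andP=> -[_ /eqP wc]; rewrite wc cX2 in w2.
Qed.

Lemma leaf_built_rooted X : leaf_built X -> exists r, rooted_tree X r.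
Proof.
elim=> [r|Y x w _ [r tY] xY wY ew]; first by exists r; apply: Rooted_single.
by exists r; apply: rooted_tree_add tY xY wY ew.
Qed.

End Trees.

(** Grow a set [X] that is connected by paths inside itself. A path of the tree to a vertex outside
    leaves [X] by some edge [xw], and [w] has no second neighbour in [X] because there is no
    cycle. *)
Lemma tree_leaf_built (U : finType) (eT : rel U) : is_tree eT -> leaf_built eT [set: U].
Proof.
case=> -[symT irrT] /card_gt0P[r _] conn acyc.
pose rX (X : {set U}) := [rel u v | [&& eT u v, u \in X & v \in X]].
have grow n : n < #|U| -> exists X : {set U},
    [/\ leaf_built eT X, #|X| = n.+1 & {in X &, forall u v, connect (rX X) u v}].
  elim: n => [|n IH] ltn.
    exists [set r]; split; [exact: Leaf_root|exact: cards1|].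
    by move=> u v; rewrite !inE => /eqP-> /eqP->; apply: connect0.
  have [X [bX cX conX]] := IH (ltnW ltn).
  have [x0 x0X] : exists x0, x0 \in X by apply/card_gt0P; rewrite cX.
  have [y0 y0X] : exists y0, y0 \notin X.
    apply/existsP; rewrite -negb_forall; apply/negP=> /forallP allX.
    suff: #|U| <= #|X| by lia.
    by apply: subset_leq_card; apply/subsetP=> u _; exact: allX.
  have [x [w [xX wX exw]]] : exists x w, [/\ x \in X, w \notin X & eT x w].
    case/connectP: (conn x0 y0) => p; elim: p x0 x0X => [|z p IHp] x xX /=.
      by move=> _ E; rewrite E xX in y0X.
    case/andP=> exz pp lst; have [zX|zX] := boolP (z \in X); first exact: IHp zX pp lst.
    by exists x, z.
  have unique v : v \in X -> eT w v = (v == x).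
    move=> vX; apply/idP/eqP=> [ewv|->]; last by rewrite symT.
    (* A second neighbour [v] would close a simple path from [x] to [v] inside [X] into a cycle
       through [w]. *)
    apply/eqP; apply/negPn/negP=> nvx.
    case/connectP: (conX x v xX vX) => p0 pp0 lst.
    case/shortenP: pp0 lst => p pp up _ lst.
    have subX : {subset x :: p <= X}.
      elim: p x xX pp {up lst exw nvx} => [|z p IHp] x xX /=.
        by move=> _ u; rewrite inE => /eqP->.
      case/andP=> /and3P[_ _ zX] pp u; rewrite inE => /orP[/eqP->//|].
      exact: IHp zX pp u.
    apply: (negP (acyc (w :: x :: p) _ _)).
    - rewrite /= in up *; rewrite up andbT; apply/negP=> wxp.
      by rewrite (subX _ wxp) in wX.
    - by case: p lst {pp up subX} => [E|//]; rewrite E eqxx in nvx.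
    rewrite /= symT exw /= rcons_path -lst symT ewv andbT.
    by apply: sub_path pp => a b /and3P[].
  exists (w |: X); split.
  - exact: Leaf_add bX xX wX unique.
  - by rewrite cardsU1 wX cX.
  have sub : subrel (rX X) (rX (w |: X)).
    by move=> a b /and3P[eab aX bX'] /=; rewrite eab !inE aX bX' !orbT.
  have symX : connect_sym (rX (w |: X)).
    by apply: sym_connect_sym => a b /=; rewrite symT (andbC (a \in _)).
  have toX u : u \in w |: X -> connect (rX (w |: X)) u x.
    rewrite !inE => /orP[/eqP->|uX].
      by apply: connect1; rewrite /= symT exw !inE eqxx xX orbT.
    by apply: connect_sub (conX u x uX xX) => a b ab; apply/connect1/sub.
  by move=> u v uX vX; apply: connect_trans (toX u uX) _; rewrite symX; apply: toX.
have U0 : 0 < #|U| by apply/card_gt0P; exists r.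
have [|X [bX cX _]] := grow #|U|.-1; first lia.
suff <- : X = [set: U] by [].
by apply/eqP; rewrite eqEcard subsetT cardsT cX; lia.
Qed.

(** * Supported labellings *)

Section Supports.
Variables (U V : finType) (eT : rel U) (eG : rel V).

(** When [phi] is injective on [X] and the blocks are disjoint, such a copy is automatically
    injective. The boolean form lets the supported labellings be counted and serve as Ramsey
    colours. *)
Definition supports (I : Type) (A : I -> {set V}) (X : {set U}) (phi : U -> I) : bool :=
  [exists f : {ffun U -> V}, [forall u in X,
    (f u \in A (phi u)) && [forall v in X, eG (f u) (f v) == eT u v]]].

Lemma supportsP (I : Type) (A : I -> {set V}) (X : {set U}) (phi : U -> I) :
  reflect (exists f : U -> V, {in X, forall u, f u \in A (phi u)} /\
             {in X &, forall u v, eG (f u) (f v) = eT u v})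
          (supports A X phi).
Proof.
apply: (iffP existsP) => [[f /forall_inP fP]|[f [fA fE]]].
  exists f; split=> [u /fP/andP[]//|u v /fP/andP[_ /forall_inP H] /H/eqP//].
exists (finfun f); apply/forall_inP=> u uX; rewrite !ffunE fA //=.
by apply/forall_inP=> v vX; rewrite !ffunE fE.
Qed.

Lemma eq_supports_blocks (I J : Type) (A : I -> {set V}) (B : J -> {set V})
    (X : {set U}) (phi : U -> I) (psi : U -> J) :
  {in X, forall u, A (phi u) = B (psi u)} -> supports A X phi = supports B X psi.
Proof.
move=> E; apply/supportsP/supportsP => -[f [fA fE]]; exists f; split=> // u uX.
  by rewrite -E // fA.
by rewrite E // fA.
Qed.

Lemma eq_supports (I : Type) (A : I -> {set V}) (X : {set U}) (phi psi : U -> I) :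
  {in X, phi =1 psi} -> supports A X phi = supports A X psi.
Proof. by move=> E; apply: eq_supports_blocks => u /E->. Qed.

Lemma supports_subset (I : Type) (A A' : I -> {set V}) (X : {set U}) (phi : U -> I) :
  (forall i, A' i \subset A i) -> supports A' X phi -> supports A X phi.
Proof.
move=> sA /supportsP[f [fA fE]]; apply/supportsP; exists f; split=> // u uX.
exact: subsetP (sA _) _ (fA u uX).
Qed.

(** A property of the labels alone, uniform over all pairs of trees: it is obtained once and then
    used for every edge of the tree. *)
Definition joinable (I : finType) (A : I -> {set V}) (P Q : {set I}) (x y : I) :=
  forall (X1 X2 : {set U}) r c (phi : U -> I), r \in X1 -> c \in X2 ->
    phi r = x -> phi c = y ->
    {in X1, forall u, phi u \in P} -> {in X2, forall u, phi u \in Q} ->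
    {in X1 &, injective phi} -> {in X2 &, injective phi} ->
    {in X1 & X2, forall u v, eT u v = (u == r) && (v == c)} ->
    supports A X1 phi -> supports A X2 phi -> supports A (X1 :|: X2) phi.

(** * Neighbourhoods, medians and a covering argument *)

Definition nbr v := [set w | eG v w].
Definition nbrs (Z : {set V}) := [set w | [exists z in Z, eG z w]].

Lemma nbrsP (Z : {set V}) w : reflect (exists2 z, z \in Z & eG z w) (w \in nbrs Z).
Proof. by rewrite inE; apply: (iffP exists_inP). Qed.

Lemma nbrsU1 z Z : nbrs (z |: Z) = nbr z :|: nbrs Z.
Proof.
apply/setP=> w; rewrite !inE; apply/exists_inP/orP => [[y]|[zw|/exists_inP[y yZ yw]]].
- rewrite !inE => /orP[/eqP->|yZ] yw; [by left|right].
  by apply/exists_inP; exists y.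
- by exists z; rewrite ?inE ?eqxx.
- by exists y; rewrite ?inE ?yZ ?orbT.
Qed.

Hypothesis symG : symmetric eG.

Lemma double_count (S T : {set V}) :
  \sum_(z in S) #|nbr z :&: T| = \sum_(v in T) #|nbr v :&: S|.
Proof.
have E (S' T' : {set V}) : \sum_(z in S') #|nbr z :&: T'| = \sum_(z in S') \sum_(v in T') eG z v.
  apply: eq_bigr => z _; rewrite -sum1_card big_mkcond [RHS]big_mkcond /=.
  by apply: eq_bigr => v _; rewrite !inE; case: (eG z v); case: (v \in T').
rewrite !E exchange_big; apply: eq_bigr => v _; apply: eq_bigr => z _.
by rewrite symG.
Qed.

(** Take the least [m] satisfying the first bound: fewer than half of the values lie strictly below
    it, which is the second bound. *)
Lemma median (S : {set V}) (F : V -> nat) : exists m,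
  #|S| <= 2 * #|[set v in S | F v <= m]| /\ #|S| <= 2 * #|[set v in S | m <= F v]|.
Proof.
have ex : exists m, #|S| <= 2 * #|[set v in S | F v <= m]|.
  exists (\max_v F v); rewrite (_ : [set _ in _ | _] = S); first lia.
  by apply/setP=> v; rewrite !inE leq_bigmax andbT.
case: (ex_minnP ex) => -[|m] Hm minm.
  exists 0; split=> //; rewrite (_ : [set _ in _ | _] = S); first lia.
  by apply/setP=> v; rewrite !inE andbT.
exists m.+1; split=> //.
have ltm : 2 * #|[set v in S | F v <= m]| < #|S|.
  by rewrite ltnNge; apply/negP=> /minm; rewrite ltnn.
have := cardsID [set v | F v <= m] S.
rewrite (_ : S :&: _ = [set v in S | F v <= m]); last by apply/setP=> v; rewrite !inE.
rewrite (_ : S :\: _ = [set v in S | m < F v]); first by lia.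
by apply/setP=> v; rewrite !inE -ltnNge andbC.
Qed.

Variable mu : nat.
Hypothesis deg_mu : forall v, #|nbr v| <= mu.

(* The vertices of [S] have degree at least [lam / H] into [Vc] and those of the
   [R i] at most [lam], so by averaging some vertex of [Vc] covers about as much
   of the rest of [S] as of all the [R i] together; collect such vertices. *)
Lemma leaf_cover (I : finType) (Vc S : {set V}) (J : {set I}) (R : I -> {set V})
    (w lam H q c n : nat) :
  0 < w -> 0 < lam -> w <= 2 * q * #|S| -> q <= c -> 4 * q * H * #|J| < c ->
  {in S, forall v, lam <= H * #|nbr v :&: Vc|} ->
  (forall i, #|R i| <= w) ->
  {in J, forall i, {in R i, forall v, #|nbr v :&: Vc| <= lam}} ->
  4 * c * n <= w ->
  exists Z : {set V}, [/\ Z \subset Vc, n <= #|nbrs Z :&: S|, #|nbrs Z :&: S| <= n + mu &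
    \sum_(i in J) #|nbrs Z :&: R i| <= c * #|nbrs Z :&: S|].
Proof.
move=> w0 lam0 bigS leqc ltc degS cR degR; elim: n => [|n IH] len.
  have E (T : {set V}) : nbrs set0 :&: T = set0.
    apply/setP=> v; rewrite !inE; apply/negP=> /andP[/exists_inP[z]].
    by rewrite inE.
  exists set0; rewrite E cards0 sub0set; split=> //.
  by rewrite big1 // => i _; rewrite E cards0.
have [|Z [subZ geZ leZ sumZ]] := IH; first lia.
have [gt|le] := ltnP n #|nbrs Z :&: S|; first by exists Z; split=> //; lia.
have {geZ leZ} {}le : #|nbrs Z :&: S| = n by lia.
pose S' := S :\: nbrs Z.
have cS' : #|S| = n + #|S'| by rewrite -le setIC cardsID.
(* As [q <= c] and [4 * c * n <= w], the [n] vertices already covered account for at most half of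
   the bound [bigS]. *)
have bigS' : w <= 4 * q * #|S'| by nia.
have [z [zV z0 zc]] : exists z, [/\ z \in Vc, 0 < #|nbr z :&: S'| &
    \sum_(i in J) #|nbr z :&: R i| <= c * #|nbr z :&: S'|].
  (* Otherwise, for every [z] in [Vc], [c] times what it covers of [S'] is at most what it covers of
     the [R i]. Counting the edges from both sides gives [c * #|S'| <= H * #|J| * w]; with [bigS']
     this contradicts the lower bound on [c]. *)
  apply: NNPP => no.
  have leall : c * \sum_(z in Vc) #|nbr z :&: S'| <= \sum_(z in Vc) \sum_(i in J) #|nbr z :&: R i|.
    rewrite big_distrr /=; apply: leq_sum => z zV.
    have [E|pos] := posnP #|nbr z :&: S'|; first by rewrite E muln0.
    by rewrite leqNgt; apply/negP=> /ltnW lt; apply: no; exists z.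
  rewrite exchange_big /= double_count in leall.
  have up : \sum_(i in J) \sum_(z in Vc) #|nbr z :&: R i| <= #|J| * (w * lam).
    rewrite -sum_nat_const; apply: leq_sum => i iJ; rewrite double_count.
    apply: (@leq_trans (\sum_(v in R i) lam)); first by apply: leq_sum => v; apply: degR.
    by rewrite sum_nat_const leq_mul2r cR orbT.
  have low : #|S'| * lam <= H * \sum_(v in S') #|nbr v :&: Vc|.
    rewrite -sum_nat_const big_distrr /=; apply: leq_sum => v; rewrite inE => /andP[_].
    exact: degS.
  have h1 : c * (#|S'| * lam) <= H * (#|J| * (w * lam)).
    apply: (@leq_trans (H * (c * \sum_(v in S') #|nbr v :&: Vc|))).
      by rewrite [leqRHS]mulnCA leq_mul2l low orbT.
    by rewrite leq_mul2l (leq_trans leall up) orbT.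
  have h2 : c * (w * lam) <= 4 * q * (H * (#|J| * (w * lam))).
    apply: (@leq_trans (4 * q * (c * (#|S'| * lam)))); last by rewrite leq_mul2l h1 orbT.
    have : c * (w * lam) <= c * (4 * q * #|S'| * lam) by rewrite leq_mul2l leq_mul2r bigS' !orbT.
    by move/leq_trans; apply; apply: eq_leq; lia.
  have h3 : 4 * q * H * #|J| * (w * lam) < c * (w * lam) by rewrite ltn_pmul2r // muln_gt0 w0.
  by move: (leq_trans h3 h2); rewrite -!mulnA ltnn.
have cov (T : {set V}) : #|nbrs (z |: Z) :&: T| <= #|nbr z :&: T| + #|nbrs Z :&: T|.
  by rewrite nbrsU1 setIUl; apply: leq_card_setU.
have covS : #|nbrs (z |: Z) :&: S| = n + #|nbr z :&: S'|.
  rewrite -le -(cardsID (nbrs Z) (nbrs (z |: Z) :&: S)); congr (_ + _); apply: eq_card => v.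
    by rewrite nbrsU1 in_setI in_setI in_setU in_setI; case: (v \in nbrs Z); rewrite ?orbT ?andbT ?andbF.
  by rewrite nbrsU1 in_setD in_setI in_setU in_setI in_setD; case: (v \in nbrs Z); rewrite ?orbF ?andbF.
have zmu : #|nbr z :&: S'| <= mu by apply: leq_trans (deg_mu z); apply/subset_leq_card/subsetIl.
exists (z |: Z); rewrite covS; split; try lia.
  by rewrite subUset sub1set zV.
apply: (@leq_trans (\sum_(i in J) (#|nbr z :&: R i| + #|nbrs Z :&: R i|))).
  by apply: leq_sum => i _; apply: cov.
by rewrite big_split /=; lia.
Qed.

End Supports.

(** * Joining two trees, or attaching leaves *)

Section Dichotomy.
Variables (U V : finType) (eT : rel U) (eG : rel V).
Hypotheses (symT : symmetric eT) (irrT : irreflexive eT).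
Hypotheses (symG : symmetric eG) (irrG : irreflexive eG).
Local Notation supports := (supports eT eG).
Local Notation nbr := (nbr eG).
Local Notation nbrs := (nbrs eG).

Lemma join_copies (I : Type) (A : I -> {set V}) (X1 X2 : {set U}) (phi : U -> I) f1 f2 :
  [disjoint X1 & X2] ->
  {in X1, forall u, f1 u \in A (phi u)} -> {in X1 &, forall u v, eG (f1 u) (f1 v) = eT u v} ->
  {in X2, forall u, f2 u \in A (phi u)} -> {in X2 &, forall u v, eG (f2 u) (f2 v) = eT u v} ->
  {in X1 & X2, forall u v, eG (f1 u) (f2 v) = eT u v} ->
  supports A (X1 :|: X2) phi.
Proof.
move=> dis A1 E1 A2 E2 E12; apply/supportsP.
exists (fun u => if u \in X1 then f1 u else f2 u); split=> [u|u v].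
  by rewrite inE; case: ifP => [u1 _|_ /= u2]; [apply: A1|apply: A2].
rewrite !inE; case: ifP => [u1 _|_ /= u2]; case: ifP => [v1 _|_ /= v2].
- exact: E1.
- exact: E12.
- by rewrite symG symT E12.
- exact: E2.
Qed.

(** The tool for steering copies: choose in each block any part of proportion at least [1 / D], and
    each supported labelling is still realized within these parts. *)
Definition stable (D w : nat) (I : finType) (A : I -> {set V}) :=
  forall A' : I -> {set V}, (forall i, A' i \subset A i) -> (forall i, w <= D * #|A' i|) ->
  forall X (phi : U -> I), supports A X phi -> supports A' X phi.

Variables (I : finType) (A : I -> {set V}) (w mu D : nat).
Hypothesis cardA : forall i, #|A i| = w.
Hypothesis disA : forall i j, i != j -> [disjoint A i & A j].
Hypothesis deg_mu : forall v, #|nbr v| <= mu.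
Hypothesis dense : forall X Y : {set V}, [disjoint X & Y] -> mu <= #|X| -> mu <= #|Y| ->
  exists x y, [/\ x \in X, y \in Y & eG x y].
Hypothesis stA : stable D w A.
Variables (P Q : {set I}) (k : nat).
Hypotheses (disPQ : [disjoint P & Q]) (Q0 : 0 < #|Q|) (k0 : 0 < k).
Hypothesis bigP : #|Q|.+1 * k <= #|P|.
Hypotheses (mu0 : 0 < mu) (U0 : 0 < #|U|).
Let K := #|U|.
(** Large enough for [leaf_cover] with [H = 2 * K] and any set of labels inside [P]. *)
Let c := (8 * #|Q| * K * #|P|).+1.
Hypotheses (bigw : 8 * c * mu <= w) (bigD : 8 * c <= D).

(** The outcome that serves to grow a tree leaf by leaf: a tree with all labels in [[set y]] and
    injective labels is a single vertex. *)
Definition leaf_tie := exists (J : {set I}) y,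
  [/\ J \subset P, k <= #|J|, y \in Q &
      {in J, forall x, joinable eT eG A [set y] J y x}].

Let P0 : 0 < #|P|. Proof. by apply: leq_trans bigP; rewrite muln_gt0. Qed.
Let leqc : #|Q| <= c. Proof. by apply: leqW; rewrite -!mulnA mulnCA leq_pmulr // !muln_gt0 U0 P0. Qed.
Let w0 : 0 < w. Proof. by apply: leq_trans bigw; rewrite !muln_gt0. Qed.

Let D0 : 0 < D. Proof. by apply: leq_trans bigD. Qed.
Let mu2 : 2 * mu <= w.
Proof. by apply: leq_trans bigw; rewrite leq_mul2r orbC -[8]/(2 * 4) -mulnA leq_pmulr ?muln_gt0. Qed.

(* [B] is what remains of the blocks once some vertices have been covered. *)
Section Step.
Variable B : I -> {set V}.
Hypothesis subB : forall s, B s \subset A s.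
Hypothesis bigB : {in Q, forall s, w <= 2 * #|B s|}.
(** The medians to be compared are those of the largest degree into a single remaining block of
    [Q]. *)
Let dg v := \max_(s in Q) #|nbr v :&: B s|.

Lemma dg_top (S : {set V}) : exists2 y, y \in Q &
  #|S| <= #|Q| * #|[set v in S | dg v == #|nbr v :&: B y|]|.
Proof.
apply: (sum_pigeonhole Q0).
rewrite -[X in X <= _]sum1_card.
apply: (@leq_trans (\sum_(v in S) \sum_(i in Q) (dg v == #|nbr v :&: B i|))).
  apply: leq_sum => v vS.
  have [s sQ E] : {s | s \in Q & dg v = #|nbr v :&: B s|} by apply: eq_bigmax_cond.
  by rewrite (bigD1 s sQ) /= E eqxx.
rewrite exchange_big; apply: leq_sum => s _.
rewrite -sum1_card big_mkcond [X in _ <= X]big_mkcond; apply: leq_sum => v _ /=.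
by rewrite inE; case: (v \in S); case: eqP.
Qed.

(** Because the medians agree up to a factor [2 * K], [leaf_cover] finds vertices of [B y] that
    cover a fixed proportion of the upper part of block [x] and spare a fixed proportion of the
    lower halves of the other blocks of [J]. Stability puts the root of the second tree in the
    covered part and its other vertices in the spared parts; a covering vertex adjacent to that root
    is the new leaf. *)
Lemma leaf_tie_of (J : {set I}) (y : I) (lam : I -> nat) (m : nat) :
  J \subset P -> y \in Q -> 0 < m ->
  {in J, forall i, lam i <= m /\ m <= 2 * K * lam i} ->
  (forall i, w <= 2 * #|[set v in A i | dg v <= lam i]|) ->
  {in J, forall i, w <= 2 * #|Q| * #|[set v in A i | (lam i <= dg v) && (dg v == #|nbr v :&: B y|)]|} ->
  {in J, forall x, joinable eT eG A [set y] J y x}.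
Proof.
move=> JP yQ m0 near low top x xJ X1 X2 r c' phi r1 c2 phir phic phi1 phi2 inj1 inj2 cross _ sup2.
have yJ : y \notin J by apply/negP=> /(subsetP JP); rewrite (disjointFl disPQ yQ).
have X1E : X1 = [set r].
  apply/setP=> u; rewrite inE; apply/idP/eqP=> [u1|->//].
  by apply: inj1 => //; move: (phi1 u u1); rewrite inE phir => /eqP.
pose S := [set v in A x | (lam x <= dg v) && (dg v == #|nbr v :&: B y|)].
pose R i := [set v in A i | dg v <= lam i].
pose J' := J :\ x.
have cR i : #|R i| <= w.
  by rewrite -(cardA i); apply/subset_leq_card/subsetP=> v; rewrite inE => /andP[].
have cJ' : #|J'| < #|P|.
  by apply: leq_trans (subset_leq_card JP); rewrite [X in _ < X](cardsD1 x) xJ.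
have n4 : 4 * c * (w %/ (4 * c)) <= w by rewrite mulnC leq_divM.
have [| | |Z [ZB geZ leZ sumZ]] := leaf_cover (Vc := B y) (J := J') (R := R) (lam := m)
   (H := 2 * K) symG deg_mu w0 m0 (top x xJ) leqc _ _ cR _ n4.
- rewrite ltnS; apply: leq_mul (ltnW cJ').
  by rewrite mulnACA -[leqRHS]mulnA.
- move=> v; rewrite inE => /and3P[_ lv /eqP <-].
  by apply: leq_trans (near x xJ).2 _; rewrite leq_mul2l lv orbT.
- move=> i /setD1P[_ iJ] v; rewrite inE => /andP[_ lv].
  apply: leq_trans (near i iJ).1; apply: leq_trans lv.
  exact: (leq_bigmax_cond (F := fun s => #|nbr v :&: B s|)).
pose A' i := if i == x then nbrs Z :&: S else if i \in J' then R i :\: nbrs Z else A i.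
have A'A i : A' i \subset A i.
  rewrite /A'; case: eqP => [->|_].
    by apply/subsetP=> v; rewrite inE [v \in S]inE => /andP[_ /andP[]].
  case: ifP => // _; apply/subsetP=> v; rewrite inE => /andP[_].
  by rewrite inE => /andP[].
have cA' i : w <= D * #|A' i|.
  rewrite /A'; case: eqP => [_|_].
    apply: leq_trans (leq_mul bigD geZ).
    have lt : w < 4 * c * (w %/ (4 * c)).+1 by rewrite mulnC ltn_ceil.
    have n0 : 0 < w %/ (4 * c).
      rewrite divn_gt0 //; apply: leq_trans bigw.
      by apply: leq_trans (leq_pmulr _ mu0); rewrite leq_mul2r orbT.
    by move: lt (leq_pmulr c n0); rewrite -!mulnA mulnS; clear; lia.
  case: ifP => [iJ'|_]; last by rewrite cardA leq_pmull // D0.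
  (* At most [c * (w / (4 * c) + mu)], hence at most [3 * w / 8], of at least [w / 2] vertices are
     covered. *)
  have : #|nbrs Z :&: R i| <= c * #|nbrs Z :&: S|.
    by apply: leq_trans sumZ; rewrite (bigD1 i) //= leq_addr.
  have := cardsID (nbrs Z) (R i); rewrite (setIC (R i)); move: (low i); rewrite -/(R i).
  have : c * #|nbrs Z :&: S| <= c * (w %/ (4 * c) + mu) by rewrite leq_mul2l leZ orbT.
  have : 8 * #|R i :\: nbrs Z| <= D * #|R i :\: nbrs Z|.
    by rewrite leq_mul2r (leq_trans _ bigD) ?orbT // leq_pmulr.
  by move: bigw n4; rewrite mulnDr -!mulnA; clear; lia.
have /supportsP[f [fA fE]] := stA A'A cA' sup2.
have : f c' \in nbrs Z by move: (fA c' c2); rewrite phic /A' eqxx inE => /andP[].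
case/nbrsP=> z zZ zc.
have zy : z \in A y by apply: subsetP (subB y) _ (subsetP ZB _ zZ).
rewrite X1E; apply: (@join_copies _ _ _ _ _ (fun=> z) f) => //.
- rewrite disjoints1; apply/negP=> r2; move: (phi2 r r2); rewrite phir.
  exact/negP.
- by move=> u; rewrite inE => /eqP->; rewrite phir.
- by move=> u v; rewrite !inE => /eqP-> /eqP->; rewrite irrG irrT.
- by move=> u u2; apply: subsetP (A'A _) _ (fA u u2).
move=> u v; rewrite inE => /eqP-> v2; rewrite cross // eqxx /=.
case: eqP => [->//|nvc]; apply/negP=> zv.
have nvx : phi v != x by apply/eqP=> E; apply: nvc; apply: inj2; rewrite ?phic.
have vJ' : phi v \in J' by rewrite !inE nvx phi2.
move: (fA v v2); rewrite /A' (negPf nvx) vJ' inE => /andP[/negP nz _].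
by apply: nz; apply/nbrsP; exists z.
Qed.

(** Let [x] have the largest median in [P], and let [Low] hold the labels whose median is smaller by
    a factor [2 * K]. For large [Low], stability puts the root in the upper part of its block and
    the other vertices in the lower halves of theirs. *)
Lemma dominance_step : ~ leaf_tie ->
  exists x (Low : {set I}) y, [/\ x \in P, Low \subset P :\ x, k <= #|Low|, y \in Q &
   forall (X1 : {set U}) r (phi : U -> I), r \in X1 -> phi r = x ->
     {in X1, forall u, phi u \in x |: Low} -> {in X1 &, injective phi} -> supports A X1 phi ->
   exists f : U -> V, [/\ {in X1, forall u, f u \in A (phi u)},
     {in X1 &, forall u v, eG (f u) (f v) = eT u v},
     0 < #|nbr (f r) :&: B y|,
     {in Q, forall s, #|nbr (f r) :&: B s| <= #|nbr (f r) :&: B y|} &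
     {in X1 & Q, forall u s, u != r -> 2 * K * #|nbr (f u) :&: B s| <= #|nbr (f r) :&: B y|}]].
Proof.
move=> notie.
have [lam lamP] : exists lam : I -> nat, forall i,
    w <= 2 * #|[set v in A i | dg v <= lam i]| /\ w <= 2 * #|[set v in A i | lam i <= dg v]|.
  apply: (fin_all_exists (P := fun i l => w <= 2 * #|[set v in A i | dg v <= l]|
     /\ w <= 2 * #|[set v in A i | l <= dg v]|)) => i.
  by have [m] := median (A i) dg; rewrite cardA; exists m.
(* A zero median would leave half of block [i] without neighbours in [B s], against density. *)
have lam0 i : i \in P -> 0 < lam i.
  move=> iP; rewrite lt0n; apply/eqP=> E.
  have [s sQ] : exists s, s \in Q by apply/card_gt0P.
  have nis : i != s by apply/eqP=> E'; move: sQ; rewrite -E' (disjointFr disPQ iP).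
  have [] := lamP i; rewrite E => cZ _.
  have [|||z [v [zZ vB zv]]] := @dense [set v in A i | dg v <= 0] (B s).
  - apply: disjointW (disA nis) => //; apply/subsetP=> v; by rewrite inE => /andP[].
  - by move: cZ mu2; lia.
  - by move: (bigB sQ) mu2; lia.
  move: zZ; rewrite inE => /andP[_]; apply/negP; rewrite -ltnNge.
  apply: (@leq_trans #|nbr z :&: B s|); last exact: (leq_bigmax_cond (F := fun s => #|nbr z :&: B s|)).
  by apply/card_gt0P; exists v; rewrite !inE zv.
have [top topP] : exists top : I -> I, forall i, top i \in Q /\
    w <= 2 * #|Q| * #|[set v in A i | (lam i <= dg v) && (dg v == #|nbr v :&: B (top i)|)]|.
  apply: (fin_all_exists (P := fun i y => y \in Q /\
    w <= 2 * #|Q| * #|[set v in A i | (lam i <= dg v) && (dg v == #|nbr v :&: B y|)]|)) => i.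
  have [y yQ le] := dg_top [set v in A i | lam i <= dg v].
  exists y; split=> //; apply: leq_trans (lamP i).2 _.
  rewrite -mulnA leq_mul2l /=; apply: leq_trans le _; rewrite leq_mul2l; apply/orP; right.
  by apply/subset_leq_card/subsetP=> v; rewrite !inE -andbA.
have [i0 i0P] : exists i, i \in P by apply/card_gt0P.
pose x := [arg max_(i > i0 in P) lam i].
have [xP xmax] : x \in P /\ forall i, i \in P -> lam i <= lam x.
  by rewrite /x; case: arg_maxnP => // i iP imax; split.
pose Low := [set i in P | 2 * K * lam i <= lam x].
have xLow : x \notin Low by rewrite inE xP /= -ltnNge; move: (lam0 x xP) U0; rewrite -/K; nia.
(* If [Low] is small, at least [#|Q| * k] labels have medians within a factor [2 * K] of the
   maximum, and [k] of them share the block [y] where the largest degree is attained: a leaf tie. *)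
have [ltk|gek] := ltnP #|Low| k.
  case: notie; pose Rest := P :\: Low.
  have bigR : #|Q| * k <= #|Rest|.
    have := cardsID Low P; rewrite (setIidPr _) -/Rest; first by move: bigP; rewrite mulSn; lia.
    by apply/subsetP=> i; rewrite inE => /andP[].
  have [y yQ bigJ] : exists2 y, y \in Q & #|Q| * k <= #|Q| * #|[set i in Rest | top i == y]|.
    apply: (sum_pigeonhole Q0); apply: leq_trans bigR _; rewrite -sum1_card.
    rewrite (partition_big top (mem Q)) /=; last by move=> i _; case: (topP i).
    by apply: leq_sum => s _; rewrite -[leqRHS]sum1_card; apply/eq_leq/eq_bigl=> i; rewrite !inE.
  rewrite leq_pmul2l // in bigJ.
  have JP : [set i in Rest | top i == y] \subset P.
    by apply/subsetP=> i; rewrite !inE => /andP[/andP[]].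
  exists [set i in Rest | top i == y], y; split=> //.
  apply: (leaf_tie_of (lam := lam) JP yQ (lam0 x xP)) => [i|i|i].
  - rewrite !inE => /andP[/andP[nl iP] _]; rewrite iP /= -ltnNge in nl.
    by split; [apply: xmax|apply: ltnW].
  - by case: (lamP i).
  - by rewrite inE => /andP[_ /eqP <-]; case: (topP i).
exists x, Low, (top x); split=> //.
- apply/subsetP=> i iL; rewrite !inE; apply/andP; split; last by move: iL; rewrite inE => /andP[].
  by apply: contraNneq xLow => <-.
- by case: (topP x).
move=> X1 r phi r1 phir phi1 inj1 sup1.
pose S := [set v in A x | (lam x <= dg v) && (dg v == #|nbr v :&: B (top x)|)].
pose A' i := if i == x then S else if i \in Low then [set v in A i | dg v <= lam i] else A i.
have A'A i : A' i \subset A i.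
  rewrite /A'; case: eqP => [->|_]; first by apply/subsetP=> v; rewrite inE => /andP[].
  by case: ifP => // _; apply/subsetP=> v; rewrite inE => /andP[].
have cA' i : w <= D * #|A' i|.
  rewrite /A'; case: eqP => [_|_].
    apply: leq_trans (topP x).2 _; rewrite leq_mul2r; apply/orP; right.
    by apply: leq_trans bigD; apply: leq_mul.
  case: ifP => [iL|_]; last by rewrite cardA leq_pmull // D0.
  apply: leq_trans (lamP i).1 _; rewrite leq_mul2r; apply/orP; right.
  by apply: leq_trans bigD; apply: (@leq_trans (8 * 1)) => //; rewrite leq_mul2l.
have /supportsP[f [fA fE]] := stA A'A cA' sup1.
have : f r \in S by move: (fA r r1); rewrite phir /A' eqxx.
rewrite inE => /and3P[_ lamr /eqP dgr].
exists f; split=> //.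
- by move=> u u1; apply: subsetP (A'A _) _ (fA u u1).
- by rewrite -dgr; apply: leq_trans lamr; apply: lam0.
- by move=> s sQ; rewrite -dgr; apply: (leq_bigmax_cond (F := fun s => #|nbr (f r) :&: B s|)).
move=> u s u1 sQ nur.
have nux : phi u != x by apply: contra_neq nur => E; apply: inj1; rewrite ?phir.
have uL : phi u \in Low by move: (phi1 u u1); rewrite !inE (negPf nux).
move: (fA u u1); rewrite /A' (negPf nux) uL inE => /andP[_ dgu].
rewrite -dgr; apply: leq_trans lamr; move: uL; rewrite inE => /andP[_]; apply: leq_trans.
rewrite leq_mul2l; apply/orP; right; apply: leq_trans dgu.
exact: (leq_bigmax_cond (F := fun s => #|nbr (f u) :&: B s|)).
Qed.

End Step.

(** * Taking copies of first trees one after the other *)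

Lemma card_bigcupI (J : finType) (T : {set J}) (F : J -> {set V}) (S : {set V}) :
  #|(\bigcup_(i in T) F i) :&: S| <= \sum_(i in T) #|F i :&: S|.
Proof.
elim/big_rec2: _ => [|i n B _ le]; first by rewrite set0I cards0.
by rewrite setIUl (leq_trans (leq_card_setU _ _).1) // leq_add2l.
Qed.

(* A purported failure [(X1, X2, phi, (r, c))] of joinability. *)
Let failure : finType := ({set U} * {set U} * {ffun U -> I} * (U * U))%type.

Let is_failure (F : failure) :=
  let: (X1, X2, phi, (r, c)) := F in
  [/\ r \in X1 /\ c \in X2,
      {in X1, forall u, phi u \in P} /\ {in X2, forall u, phi u \in Q},
      {in X2 &, injective phi} /\ {in X1 & X2, forall u v, eT u v = (u == r) && (v == c)},
      supports A X2 phi & ~~ supports A (X1 :|: X2) phi].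

(* [v], in the block of [c], is ready to play the role of [c] next to a copy of
   [X1] all of whose neighbours in blocks of [Q] lie in [C]. *)
Let served (C : I -> {set V}) (F : failure) v :=
  let: (X1, X2, phi, (r, c)) := F in
  v \in C (phi c) /\ exists f : U -> V,
  [/\ {in X1, forall u, f u \in A (phi u)},
      {in X1 &, forall u v, eG (f u) (f v) = eT u v}, eG (f r) v,
      {in X1, forall u, u != r -> ~~ eG (f u) v} &
      {in X1 & Q, forall u s, nbr (f u) :&: A s \subset C s}].

(** [C] is covered by the copies taken so far, and [Y F] is served for the failure [F]. The failure
    at hand may change as the blocks shrink, so all of them are tracked. The last clause says that a
    fixed proportion of the covering is useful. *)
Let good_state (C : I -> {set V}) (Y : failure -> {set V}) :=
  [/\ forall s, C s \subset A s,
      forall F v, v \in Y F -> is_failure F /\ served C F v &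
      \sum_(s in Q) #|C s| <= 4 * #|Q| * \sum_F #|Y F|].

Let q2c : 2 * #|Q| <= c.
Proof.
apply: leqW; rewrite -[8]/(2 * 4) -!mulnA leq_mul2l /= mulnCA leq_pmulr //.
by rewrite !muln_gt0 U0 P0.
Qed.

Let qmu : 16 * #|Q| * mu <= w.
Proof.
apply: leq_trans bigw; rewrite -[16]/(8 * 2) -!mulnA leq_mul2l /= mulnA.
by rewrite leq_mul2r q2c orbT.
Qed.

(** Apply [dominance_step] to the uncovered parts. Joinability fails at the labels found, and the
    first tree of that failure has a copy whose root dominates. The root's neighbours in the
    uncovered part of block [y], without those of the rest of the copy, become served. *)
Lemma serve_step C Y : ~ leaf_tie ->
  (forall x (Low : {set I}) y, x \in P -> Low \subset P :\ x -> k <= #|Low| -> y \in Q ->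
     ~ joinable eT eG A (x |: Low) Q x y) ->
  good_state C Y -> 16 * #|Q| * \sum_F #|Y F| <= w ->
  exists C' Y', [/\ good_state C' Y', \sum_F #|Y F| < \sum_F #|Y' F| &
    \sum_F #|Y' F| <= \sum_F #|Y F| + mu].
Proof.
move=> notie nodom [CA YP sumC] small.
pose B s := A s :\: C s.
have subB s : B s \subset A s by apply: subsetDl.
have bigB : {in Q, forall s, w <= 2 * #|B s|}.
  move=> s sQ; have := cardsID (C s) (A s); rewrite (setIidPr (CA s)) cardA -/(B s).
  have : #|C s| <= 4 * #|Q| * \sum_F #|Y F|.
    by apply: leq_trans sumC; rewrite (bigD1 s) //= leq_addr.
  by move: small; rewrite -!mulnA; clear; lia.
have [x [Low [y [xP LP kL yQ copy]]]] := dominance_step subB bigB notie.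
have [X1 [X2 [r [c' [phi [[r1 c2 phir phic] [phi1 phi2 inj1 inj2] [cross sup1 sup2 nsup]]]]]]] :
  exists (X1 X2 : {set U}) r c (phi : U -> I), [/\ [/\ r \in X1, c \in X2, phi r = x & phi c = y],
   [/\ {in X1, forall u, phi u \in x |: Low}, {in X2, forall u, phi u \in Q},
    {in X1 &, injective phi} & {in X2 &, injective phi}] &
    [/\ {in X1 & X2, forall u v, eT u v = (u == r) && (v == c)},
    supports A X1 phi, supports A X2 phi & ~~ supports A (X1 :|: X2) phi]].
  apply: NNPP => no; apply: (nodom x Low y) => // X1 X2 r c' phi *.
  case E : (supports A (X1 :|: X2) phi) => //; case: no; exists X1, X2, r, c', phi.
  by split; split=> //; rewrite E.
have [f [fA fE d0 dmax dlow]] := copy X1 r phi r1 phir phi1 inj1 sup1.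
set d := #|nbr (f r) :&: B y| in d0 dmax dlow.
pose F0 : failure := (X1, X2, finfun phi, (r, c')).
pose Oth := \bigcup_(u in X1 :\ r) nbr (f u).
(* There are at most [K] other vertices, each with at most [d / (2 * K)] neighbours in [B s]. *)
have leOth s : s \in Q -> 2 * #|Oth :&: B s| <= d.
  move=> sQ; rewrite -(leq_pmul2l U0) mulnCA mulnA.
  apply: (@leq_trans (\sum_(u in X1 :\ r) 2 * K * #|nbr (f u) :&: B s|)).
    by rewrite -big_distrr leq_mul2l card_bigcupI orbT.
  apply: (@leq_trans (\sum_(u in X1 :\ r) d)).
    by apply: leq_sum => u /setD1P[nur u1]; apply: dlow.
  by rewrite sum_nat_const leq_mul2r max_card orbT.
pose new := (nbr (f r) :&: B y) :\: Oth.
have new_le : #|new| <= d by apply/subset_leq_card/subsetDl.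
have new_ge : d <= 2 * #|new|.
  have := cardsID Oth (nbr (f r) :&: B y); rewrite -/d -/new.
  have : #|nbr (f r) :&: B y :&: Oth| <= #|Oth :&: B y|.
    by apply/subset_leq_card/subsetP=> v; rewrite !in_setI => /andP[/andP[_ ->] ->].
  by have := leOth y yQ; clear; lia.
pose C' s := C s :|: (A s :&: (nbr (f r) :|: Oth)).
pose Y' F := if F == F0 then Y F :|: new else Y F.
have sumY' : \sum_F #|Y' F| = \sum_F #|Y F| + #|new|.
  rewrite (bigD1 F0) //= [in RHS](bigD1 F0) //= /Y' eqxx.
  rewrite (eq_bigr (fun F => #|Y F|)); last by move=> F /negPf->.
  rewrite cardsU (_ : _ :&: _ = set0) ?cards0 ?subn0; first by rewrite addnAC.
  apply/setP=> v; rewrite in_setI in_set0; apply/negP=> /andP[/YP[_ [vC _]]].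
  by rewrite ffunE phic in vC; rewrite !inE vC /= !andbF.
exists C', Y'; rewrite sumY'; split.
- split=> [s|F v|].
  + by rewrite subUset CA subsetIl.
  + have CC' s : C s \subset C' s by apply: subsetUl.
    have old : v \in Y F -> is_failure F /\ served C' F v.
      case: F => -[[Z1 Z2] psi] [a b] /YP[bad [vC [g [gA gE gv gnv gC]]]]; split=> //.
      split; first exact: subsetP (CC' _) _ vC.
      exists g; split=> // u s u1 sQ; exact: subset_trans (gC u s u1 sQ) (CC' s).
    rewrite /Y'; case: eqP => [E|_]; last exact: old.
    rewrite inE => /orP[/old//|]; rewrite E => vnew.
    move: vnew; rewrite /new /B !(in_setD, in_setI) => /and3P[vO rv /andP[vC vA]].
    have E1 (Z : {set U}) : supports A Z (finfun phi) = supports A Z phi.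
      by apply: eq_supports => u _; rewrite ffunE.
    split; first split.
    * by [].
    * split=> u uX; rewrite ffunE; last exact: phi2.
      have := phi1 u uX; rewrite !inE => /orP[/eqP->//|uL].
      by have /setD1P[] := subsetP LP _ uL.
    * by split=> // u v'; rewrite !ffunE; apply: inj2.
    * by rewrite E1.
    * by rewrite E1.
    rewrite inE in rv; split; first by rewrite ffunE phic /C' !inE vA rv orbT.
    exists f; split=> //.
    * by move=> u u1; rewrite ffunE; apply: fA.
    * move=> u u1 nur; apply: contra vO => uv; apply/bigcupP; exists u; rewrite ?inE //.
      by rewrite nur.
    move=> u s u1 sQ; rewrite setIC /C'; apply: subset_trans (subsetUr _ _); apply: setIS.
    have [->|nur] := eqVneq u r; first exact: subsetUl.
    by apply: subset_trans (subsetUr _ _); apply: (bigcup_sup u (F := fun u => nbr (f u))); rewrite !inE nur.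
  + rewrite sumY'.
    (* Each block of [Q] gains at most [d + d / 2] covered vertices while at least [d / 2] vertices
       become served, so at most [3 * #|Q|] are covered for each one served. *)
    have cC' s : s \in Q -> 2 * #|C' s| <= 2 * #|C s| + 3 * d.
      move=> sQ; have : #|C' s| <= #|C s| + (#|nbr (f r) :&: B s| + #|Oth :&: B s|).
        apply: (@leq_trans #|C s :|: ((nbr (f r) :&: B s) :|: (Oth :&: B s))|).
          apply/subset_leq_card/subsetP=> v; rewrite -setIUl /C' /B !in_setU !in_setI in_setU in_setD.
          by case: (v \in C s) => //= /andP[-> ->].
        apply: leq_trans (leq_card_setU _ _).1 _; rewrite leq_add2l.
        exact: (leq_card_setU _ _).1.
      by have := leOth s sQ; have := dmax s sQ; clear; lia.
    have : 2 * \sum_(s in Q) #|C' s| <= 2 * \sum_(s in Q) #|C s| + #|Q| * (3 * d).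
      by rewrite !big_distrr -sum_nat_const -big_split /=; apply: leq_sum.
    have : #|Q| * (3 * d) <= #|Q| * (3 * (2 * #|new|)) by rewrite !leq_mul2l new_ge !orbT.
    by move: sumC; clear; nia.
- by rewrite -addn1 leq_add2l; move: d0 new_ge; clear; lia.
- by rewrite leq_add2l (leq_trans new_le) // (leq_trans _ (deg_mu (f r))) // subset_leq_card ?subsetIl.
Qed.

(** If neither outcome holds, serving continues until one failure [F] has a fixed proportion of a
    block served. By stability its second tree has a copy with root in [Y F] and its other vertices
    outside [C]. The copy of the first tree that serves this root has no other neighbour there, so
    the two are joined and [F] is no failure. *)
Lemma dichotomy : 32 * #|Q| * #|failure| <= D -> leaf_tie \/
  exists x (Low : {set I}) y, [/\ x \in P, Low \subset P :\ x, k <= #|Low|, y \in Q &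
    joinable eT eG A (x |: Low) Q x y].
Proof.
move=> bigD'; have [|notie] := classic leaf_tie; first by left.
right; apply: NNPP => nodom.
have run n : 16 * #|Q| * n <= w -> exists C Y, [/\ good_state C Y,
    n <= \sum_F #|Y F| & \sum_F #|Y F| <= n + mu].
  elim: n => [|n IH] len.
    exists (fun=> set0), (fun=> set0); split; rewrite ?big1 // => *; rewrite ?cards0 //.
    split=> [s|F v|]; rewrite ?sub0set ?inE //.
    by rewrite big1 // => s _; rewrite cards0.
  have len' : 16 * #|Q| * n <= w by apply: leq_trans len; rewrite leq_mul2l leqnSn orbT.
  have [C [Y [gCY geY leY]]] := IH len'.
  have [gt|le] := ltnP n (\sum_F #|Y F|).
    by exists C, Y; split=> //; apply: leq_trans leY _; rewrite leq_add2r.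
  have E : \sum_F #|Y F| = n by apply/eqP; rewrite eqn_leq le.
  have [| |C' [Y' [gCY' lt leY']]] := serve_step notie _ gCY.
  - by move=> x Low y xP LP kL yQ jn; apply: nodom; exists x, Low, y.
  - by rewrite E.
  exists C', Y'; split=> //; first by rewrite -E.
  by apply: leq_trans leY' _; rewrite E leq_add2r.
(* Small enough that half of each block of [Q] stays uncovered, and still at least
   [w / (32 * #|Q|)]. *)
pose n := w %/ (16 * #|Q|).
have q0 : 0 < 16 * #|Q| by rewrite muln_gt0.
have n16 : 16 * #|Q| * n <= w by rewrite mulnC leq_divM.
have n0 : 0 < n by rewrite divn_gt0 // (leq_trans _ qmu) // leq_pmulr.
have [C [Y [[CA YP sumC] geY leY]]] := run n n16.
have [F geF] : exists F, n <= #|failure| * #|Y F|.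
  have sumE : \sum_F #|Y F| = \sum_(F in [set: failure]) #|Y F|.
    by apply: eq_bigl => F; rewrite inE.
  rewrite sumE in geY; have [|F _] := sum_pigeonhole _ geY; last first.
    by rewrite cardsT; exists F.
  rewrite lt0n; apply/eqP=> /cards0_eq E; move: geY; rewrite E big_set0.
  by rewrite leqNgt n0.
have [y0 y0Y] : exists v, v \in Y F.
  by apply/card_gt0P; rewrite lt0n; apply/eqP=> E; rewrite E muln0 leqNgt n0 in geF.
have [bad _] := YP F y0 y0Y.
have YPF v := YP F v.
case: F geF bad YPF y0Y => -[[X1 X2] phi] [r c'] geF bad YPF y0Y.
case: bad => [[r1 c2] [phi1 phi2] [inj2 cross] sup2 /negP[]].
set F : failure := (X1, X2, phi, (r, c')) in geF YPF y0Y.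
pose A' i := if i == phi c' then Y F else if i \in Q then A i :\: C i else A i.
have wlt : w <= 32 * #|Q| * n.
  have lt : w < 16 * #|Q| * n.+1 by rewrite mulnC ltn_ceil.
  by have := leq_pmulr #|Q| n0; move: lt; rewrite -!mulnA mulnS; clear; lia.
have A'A i : A' i \subset A i.
  rewrite /A'; case: eqP => [->|_]; last by case: ifP => // _; apply: subsetDl.
  by apply/subsetP=> v /YPF[_ [vC _]]; apply: subsetP (CA _) _ vC.
have cA' i : w <= D * #|A' i|.
  rewrite /A'; case: eqP => [_|_].
    apply: leq_trans wlt _; apply: leq_trans (leq_mul bigD' (leqnn _)).
    by rewrite -[leqRHS]mulnA leq_mul2l geF orbT.
  case: ifP => [iQ|_]; last by rewrite cardA leq_pmull // D0.
  have : 8 * #|A i :\: C i| <= D * #|A i :\: C i|.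
    by rewrite leq_mul2r (leq_trans _ bigD) ?orbT // leq_pmulr.
  have := cardsID (C i) (A i); rewrite (setIidPr (CA i)) cardA.
  have : #|C i| <= 4 * #|Q| * (n + mu).
    apply: (@leq_trans (4 * #|Q| * \sum_F #|Y F|)); last by rewrite leq_mul2l leY orbT.
    by apply: leq_trans sumC; rewrite (bigD1 i) //= leq_addr.
  by move: n16 qmu; rewrite mulnDr -!mulnA; clear; lia.
have /supportsP[g [gA gE]] := stA A'A cA' sup2.
have gcY : g c' \in Y F by have := gA c' c2; rewrite /A' eqxx.
have [_ [_ [f [fA fE rv nrv fC]]]] := YPF _ gcY.
apply: (@join_copies _ _ _ _ _ f g) => //.
- rewrite -setI_eq0; apply/eqP/setP=> u; rewrite in_setI in_set0; apply/negP=> /andP[u1 u2].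
  by have := phi2 u u2; rewrite (disjointFr disPQ (phi1 u u1)).
- by move=> u u2; apply: subsetP (A'A _) _ (gA u u2).
move=> u v u1 v2; rewrite cross //; have [->|nvc] := eqVneq v c'.
  by rewrite andbT; have [->//|nur] := eqVneq u r; apply/negbTE/nrv.
rewrite andbF; apply/negP=> uv.
have nphi : phi v != phi c' by apply: contra_neq nvc; apply: inj2.
have := gA v v2; rewrite /A' (negPf nphi) phi2 // inE => /andP[/negP nC vA].
by apply: nC; apply: subsetP (fC u (phi v) u1 (phi2 v v2)) _ _; rewrite !inE uv.
Qed.

End Dichotomy.

(** * Order-invariant blockades *)

Section Directed.
Variable n : nat.
Implicit Types (d : bool) (S : {set 'I_n}).

Definition ltd d (i j : 'I_n) := if d then i < j else j < i.

Lemma ltd_trans d : transitive (ltd d).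
Proof. by rewrite /ltd => j i k; case: d => ? ?; lia. Qed.

Lemma ltd_irr d : irreflexive (ltd d).
Proof. by move=> i; rewrite /ltd; case: d; rewrite ltnn. Qed.

Lemma ltdN d i j : ltd (~~ d) i j = ltd d j i.
Proof. by case: d. Qed.

Lemma sort_ltd d (s : seq 'I_n) : uniq s ->
  exists t, [/\ sorted (ltd d) t, t =i s & size t = size s].
Proof.
move=> us; pose le (i j : 'I_n) := if d then i <= j else j <= i.
have le_tot : total le by move=> i j; rewrite /le; case: (d); lia.
have le_tr : transitive le by move=> j i k; rewrite /le; case: (d) => ? ?; lia.
exists (sort le s); split; [|exact: mem_sort|exact: size_sort].
rewrite (sorted_pairwise (@ltd_trans d)).
have h1 : pairwise le (sort le s) by rewrite -(sorted_pairwise le_tr) sort_sorted.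
have h2 : pairwise [rel i j | i != j] (sort le s) by rewrite -uniq_pairwise sort_uniq.
have := conj h1 h2; move/andP; rewrite -pairwise_relI; apply: sub_pairwise => i j /= /andP[].
by rewrite /le /ltd -val_eqE /=; case: (d) => ? ?; lia.
Qed.

Lemma enum_ltd d S : exists t, [/\ sorted (ltd d) t, t =i S & size t = #|S|].
Proof.
have [t [st mt zt]] := sort_ltd d (enum_uniq S); exists t; split=> // [i|]; last by rewrite zt -cardE.
by rewrite mt mem_enum.
Qed.

Lemma cons_enum_ltd d x S : {in S, forall z, ltd d x z} ->
  exists t, [/\ sorted (ltd d) (x :: t), t =i S & size t = #|S|].
Proof.
move=> xS; have [t [st mt zt]] := enum_ltd d S; exists t; split=> //=.
rewrite (path_sortedE (@ltd_trans d)) st andbT; apply/allP=> z; rewrite mt; exact: xS.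
Qed.

Lemma one_sided x S k : x \notin S -> 2 * k <= #|S| ->
  exists d, k <= #|[set z in S | ltd d x z]|.
Proof.
move=> xS big.
have := cardsID [set z | ltd true x z] S.
rewrite (_ : S :&: _ = [set z in S | ltd true x z]); last by apply/setP=> z; rewrite !inE.
rewrite (_ : S :\: _ = [set z in S | ltd false x z]).
  move=> sum; case: (leqP k #|[set z in S | ltd true x z]|) => le; first by exists true.
  exists false; rewrite leqNgt; apply/negP=> lt.
  by have := leq_add le (ltnW lt); rewrite addSn sum addnn -mul2n ltnNge big.
apply/setP=> z; rewrite !inE andbC; case zS: (z \in S) => //=.
have : z != x by apply: contraNneq xS => <-.
by rewrite -val_eqE /= /ltd; lia.
Qed.

End Directed.

(** * Placing rooted trees by the order of their labels, and grafting them *)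

Section Assembly.
Variables (U V : finType) (eT : rel U) (eG : rel V).
Hypotheses (irrT : irreflexive eT) (irrG : irreflexive eG).
Variables (n : nat) (A : 'I_n -> {set V}) (i0 : 'I_n).
Hypothesis A0 : forall i, A i != set0.
Local Notation supports := (supports eT eG).
Local Notation joinable := (joinable eT eG).
Local Notation ltd := (@ltd n).

(** Labellings are written as ranks [rho] in a sorted list of labels; replacing the list keeps the
    order of the labels. *)
Definition order_invariant d := forall (X : {set U}) (rho : U -> nat) (s s' : seq 'I_n),
  {in X, forall u, rho u < #|X|} -> sorted (ltd d) s -> sorted (ltd d) s' ->
  size s = #|X| -> size s' = #|X| ->
  supports A X (fun u => nth i0 s (rho u)) -> supports A X (fun u => nth i0 s' (rho u)).

Lemma order_invariant_rev : order_invariant true -> order_invariant false.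
Proof.
move=> inv X rho s s' lt ss ss' zs zs'.
have rsort (t : seq 'I_n) : sorted (ltd false) t -> sorted (ltd true) (rev t).
  by move=> st; rewrite rev_sorted; apply: sub_sorted st.
pose rho' u := #|X|.-1 - rho u.
have E (t : seq 'I_n) : size t = #|X| ->
    supports A X (fun u => nth i0 t (rho u)) = supports A X (fun u => nth i0 (rev t) (rho' u)).
  move=> zt; apply: eq_supports => u uX; have := lt u uX => ltu.
  rewrite nth_rev /rho' zt; [congr nth|]; lia.
rewrite !E //; apply: inv; rewrite ?size_rev ?rsort // => u uX.
by have := lt u uX; rewrite /rho'; lia.
Qed.

Hypothesis inv : forall d, order_invariant d.

(* Whatever labels are used, [X] is found in the corresponding blocks with the
   vertices in an order that starts, in direction [d], with [r]. *)
Definition placeable d (X : {set U}) (r : U) := exists rho : U -> nat,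
  [/\ {in X &, injective rho}, {in X, forall u, rho u < #|X|}, rho r = 0 &
   forall s, sorted (ltd d) s -> size s = #|X| -> supports A X (fun u => nth i0 s (rho u))].

(** By order invariance one realized labelling with extremal root label is enough; the ranks are the
    positions in the sorted list of its labels. *)
Lemma placeable_of d (X : {set U}) (phi : U -> 'I_n) r : r \in X -> {in X &, injective phi} ->
  {in X, forall u, u != r -> ltd d (phi r) (phi u)} -> supports A X phi -> placeable d X r.
Proof.
move=> rX injp least sup.
have us : uniq [seq phi u | u <- enum X].
  by rewrite map_inj_in_uniq ?enum_uniq // => u v; rewrite !mem_enum; apply: injp.
have [s [ss ms zs]] := sort_ltd d us; rewrite size_map -cardE in zs.
have mem_s u : u \in X -> phi u \in s.
  by move=> uX; rewrite ms; apply: map_f; rewrite mem_enum.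
exists (fun u => index (phi u) s); split=> [u v uX vX E|u uX||s' ss' zs'].
- apply: injp => //; have := congr1 (nth i0 s) E; by rewrite !nth_index ?mem_s.
- by rewrite -zs index_mem mem_s.
- have := mem_s r rX; case: s ss ms {zs mem_s} => // h s ss ms; rewrite inE /=.
  case: (eqVneq h (phi r)) => //= nh rs.
  have /mapP[u uX hE] : h \in [seq phi u | u <- enum X] by rewrite -ms mem_head.
  rewrite mem_enum in uX.
  have lt1 : ltd d (phi r) h by rewrite hE least //; apply: contraNneq nh => <-; rewrite hE.
  have /allP/(_ _ rs) lt2 := order_path_min (@ltd_trans n d) ss.
  by have := ltd_trans lt1 lt2; rewrite ltd_irr.
apply: (inv (s := s) (d := d)) => // [u uX|]; first by rewrite -zs index_mem mem_s.
by rewrite (eq_supports eT eG A (psi := phi)) // => u uX; rewrite nth_index ?mem_s.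
Qed.

Lemma placeableE d (X : {set U}) r s : placeable d X r -> sorted (ltd d) s -> #|X| <= size s ->
  exists phi : U -> 'I_n, [/\ {in X &, injective phi}, {in X, forall u, phi u \in s},
    phi r = nth i0 s 0 & supports A X phi].
Proof.
move=> [rho [injr ltr rho0 sup]] ss zs.
have us : uniq s := sorted_uniq (@ltd_trans n d) (@ltd_irr n d) ss.
exists (fun u => nth i0 s (rho u)); split=> [u v uX vX|u uX||].
- move/eqP; rewrite nth_uniq //; first by move/eqP; apply: injr.
  + exact: leq_trans (ltr u uX) zs.
  + exact: leq_trans (ltr v vX) zs.
- by rewrite mem_nth // (leq_trans (ltr u uX)).
- by rewrite rho0.
have zt : size (take #|X| s) = #|X| by rewrite size_take; case: ltngtP zs => // ->.
rewrite (eq_supports eT eG A (psi := fun u => nth i0 (take #|X| s) (rho u))).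
  by apply: sup => //; apply: take_sorted.
by move=> u uX; rewrite nth_take // ltr.
Qed.

Lemma supports1 r (phi : U -> 'I_n) : supports A [set r] phi.
Proof.
have /set0Pn[v vA] := A0 (phi r); apply/supportsP; exists (fun=> v); split=> [u|u u'].
  by rewrite inE => /eqP->.
by rewrite !inE => /eqP-> /eqP->; rewrite irrG irrT.
Qed.

Lemma placeable1 d r : placeable d [set r] r.
Proof.
apply: (placeable_of (phi := fun=> i0)); rewrite ?inE //; last exact: supports1.
- by move=> u v; rewrite !inE => /eqP-> /eqP->.
- by move=> u; rewrite inE => /eqP->; rewrite eqxx.
Qed.

(** Place [X1] from [x] on and [X2] from [y] on, then join them. As [x] precedes both [t1] and [Q],
    the root label is extremal again. Either tree may be the one whose copies are taken first. *)
Lemma join_placeable a b (X1 X2 : {set U}) r c (P Q : {set 'I_n}) x t1 y t2 :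
  placeable b X1 r -> placeable a X2 c -> r \in X1 -> c \in X2 -> [disjoint X1 & X2] ->
  {in X1 & X2, forall u v, eT u v = (u == r) && (v == c)} -> symmetric eT ->
  [disjoint P & Q] -> {subset x :: t1 <= P} -> {subset y :: t2 <= Q} ->
  sorted (ltd b) (x :: t1) -> sorted (ltd a) (y :: t2) ->
  #|U| <= (size t1).+1 -> #|U| <= (size t2).+1 ->
  {in Q, forall z, ltd b x z} -> joinable A P Q x y \/ joinable A Q P y x ->
  placeable b (X1 :|: X2) r.
Proof.
move=> p1 p2 r1 c2 dis cross symT disPQ sP sQ so1 so2 z1 z2 xQ jn.
have [|phi1 [inj1 in1 r1E sup1]] := placeableE p1 so1.
  exact: leq_trans (max_card _) z1.
have [|phi2 [inj2 in2 c2E sup2]] := placeableE p2 so2.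
  exact: leq_trans (max_card _) z2.
pose phi u := if u \in X1 then phi1 u else phi2 u.
have E1 : {in X1, phi =1 phi1} by move=> u u1; rewrite /phi u1.
have E2 : {in X2, phi =1 phi2} by move=> u u2; rewrite /phi (disjointFl dis u2).
have P1 : {in X1, forall u, phi u \in P} by move=> u u1; rewrite E1 //; apply/sP/in1.
have Q2 : {in X2, forall u, phi u \in Q} by move=> u u2; rewrite E2 //; apply/sQ/in2.
have injp1 : {in X1 &, injective phi} by move=> u v u1 v1; rewrite !E1 //; apply: inj1.
have injp2 : {in X2 &, injective phi} by move=> u v u2 v2; rewrite !E2 //; apply: inj2.
have s1 : supports A X1 phi by rewrite (eq_supports eT eG A (psi := phi1)).
have s2 : supports A X2 phi by rewrite (eq_supports eT eG A (psi := phi2)).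
apply: (placeable_of (phi := phi)); first by rewrite inE r1.
- move=> u v; rewrite !inE => /orP[u1|u2] /orP[v1|v2] E.
  + exact: injp1.
  + by have := Q2 v v2; rewrite -E (disjointFr disPQ (P1 u u1)).
  + by have := Q2 u u2; rewrite E (disjointFr disPQ (P1 v v1)).
  + exact: injp2.
- move=> u uX nur; rewrite [phi r]E1 // r1E /=; move: uX; rewrite inE => /orP[u1|u2].
    have := in1 u u1; rewrite inE E1 // => /orP[/eqP E|ut].
      by case/eqP: nur; apply: inj1; rewrite // r1E.
    by have /allP := order_path_min (@ltd_trans n b) so1; apply.
  by apply: xQ; apply: Q2.
have rE : phi r = x by rewrite E1.
have cE : phi c = y by rewrite E2.
case: jn => [jn|jn]; first exact: (jn X1 X2 r c phi).
rewrite setUC; apply: (jn X2 X1 c r phi) => //.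
by move=> u v u2 v1; rewrite symT cross // andbC.
Qed.

(** [b] is the direction of the tree that keeps its root and of the result, [a] that of the grafted
    tree. *)
Definition grafting a b := forall (X1 X2 : {set U}) r c,
  placeable b X1 r -> placeable a X2 c -> r \in X1 -> c \in X2 -> [disjoint X1 & X2] ->
  {in X1 & X2, forall u v, eT u v = (u == r) && (v == c)} ->
  placeable b (X1 :|: X2) r.

Lemma grafting_tree a X r : grafting a a -> rooted_tree eT X r -> placeable a X r.
Proof.
move=> gr; elim=> [s|X1 s X2 c t1 p1 t2 p2 dis cross]; first exact: placeable1.
by apply: gr p1 p2 _ _ dis cross; apply: rooted_tree_root; eassumption.
Qed.

(** Each grafting uses the grafted tree in the opposite direction, so the induction carries both
    directions. *)
Lemma grafting2_tree a X r : grafting a (~~ a) -> grafting (~~ a) a -> rooted_tree eT X r ->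
  placeable a X r /\ placeable (~~ a) X r.
Proof.
move=> gr1 gr2; elim=> [s|X1 s X2 c t1 [p1 p1'] t2 [p2 p2'] dis cross].
  by split; apply: placeable1.
have [s1 c2] := (rooted_tree_root t1, rooted_tree_root t2).
by split; [apply: gr2 p1 p2' s1 c2 dis cross|apply: gr1 p1' p2 s1 c2 dis cross].
Qed.

Hypothesis symT : symmetric eT.
Let K := #|U|.

(* [d] is the direction from [y] to [P]. *)
Lemma graftings d (P QL QR : {set 'I_n}) x y (Low : {set 'I_n}) :
  [disjoint P & QL :|: QR] -> x \in P -> Low \subset P :\ x -> 2 * K <= #|Low| ->
  y \in QL -> 2 * K < #|QL| -> K <= #|QR| ->
  {in QL & P, forall i j, ltd d i j} -> {in QL & QR, forall i j, ltd d i j} ->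
  joinable A (x |: Low) (QL :|: QR) x y ->
  (exists a, grafting a a) \/ grafting d (~~ d) /\ grafting (~~ d) d.
Proof.
move=> disPQ xP LP kL yQ kQL kQR ltLP ltLR jn.
have xLP : {subset x |: Low <= P}.
  by move=> z; rewrite !inE => /orP[/eqP->//|/(subsetP LP)/setD1P[]].
have dis : [disjoint x |: Low & QL :|: QR] by apply: disjointWl disPQ; apply/subsetP.
have xLow : x \notin Low by apply/negP=> /(subsetP LP); rewrite !inE eqxx.
have jn_sub (P' Q' : {set 'I_n}) : P' \subset x |: Low -> Q' \subset QL :|: QR ->
    joinable A P' Q' x y.
  move=> sP sQ X1 X2 r c phi r1 c2 rE cE h1 h2; apply: jn => // u uX.
    by apply: (subsetP sP); apply: h1.
  by apply: (subsetP sQ); apply: h2.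
have side a : [set z in Low | ltd a x z] \subset Low by apply/subsetP=> z; rewrite inE => /andP[].
have [a ka] := one_sided xLow kL.
have [|t [st mt zt]] := @cons_enum_ltd n a x [set z in Low | ltd a x z].
  by move=> z; rewrite inE => /andP[].
have tP : {subset x :: t <= x |: Low}.
  by move=> z; rewrite !inE mt inE => /orP[->//|/andP[-> _]]; rewrite orbT.
(* Here [Low] continues beyond [x], away from [y]. The root goes to [y], with [QR] as room for the
   rest of its tree. *)
have [E|nE] := eqVneq a d.
  left; exists d => X1 X2 r c p1 p2 r1 c2 disX cross.
  have [|t' [st' mt' zt']] := @cons_enum_ltd n d y QR; first by move=> z zR; apply: ltLR.
  rewrite E in st.
  apply: (join_placeable (P := y |: QR) (Q := x |: Low) p1 p2 r1 c2 disX cross symT _ _ tP st' st).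
  - rewrite disjoint_sym; apply: disjointWr dis.
    by apply/subsetP=> z; rewrite !inE => /orP[/eqP->|->]; rewrite ?yQ ?orbT.
  - by move=> z; rewrite !inE mt'.
  - by rewrite zt' leqW.
  - by rewrite zt leqW.
  - by move=> z /xLP zP; apply: ltLP.
  right; apply: jn_sub => //.
  by apply/subsetP=> z; rewrite !inE => /orP[/eqP->|->]; rewrite ?yQ ?orbT.
have {nE} aE : a = ~~ d by case: (a) (d) nE => -[].
(* From here on the labels used from [Low] lie between [y] and [x], and the side of [y] with many
   labels of [QL] decides. *)
rewrite aE in st.
have ynQ : y \notin QL :\ y by rewrite !inE eqxx.
have [b kb] : exists b, K <= #|[set z in QL :\ y | ltd b y z]|.
  by apply: one_sided => //; move: kQL; rewrite (cardsD1 y) yQ add1n ltnS.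
have [|t' [st' mt' zt']] := @cons_enum_ltd n b y [set z in QL :\ y | ltd b y z].
  by move=> z; rewrite inE => /andP[].
have tQ : {subset y :: t' <= QL}.
  move=> z; rewrite inE mt' => /orP[/eqP->//|].
  by rewrite !inE => /andP[/andP[]].
have disL : [disjoint x |: Low & QL] by apply: disjointWr dis; apply: subsetUl.
have jnL : joinable A (x |: Low) QL x y by apply: jn_sub => //; apply: subsetUl.
have ltx : {in QL, forall z, ltd (~~ d) x z} by move=> z zQ; rewrite ltdN; apply: ltLP.
(* The tree at [y] runs away from [x]: both trees have direction [~~ d], and [x] is extremal. *)
have [E|nE] := eqVneq b (~~ d).
  left; exists (~~ d) => X1 X2 r c p1 p2 r1 c2 disX cross; rewrite E in st'.
  apply: (join_placeable p1 p2 r1 c2 disX cross symT disL tP tQ st st' _ _ ltx).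
  - by rewrite zt leqW.
  - by rewrite zt' leqW.
  by left.
have {nE} bE : b = d by case: (b) (d) nE => -[].
(* The two trees run towards each other, so either root label can be the extremal one. *)
rewrite bE in st'.
right; split=> X1 X2 r c p1 p2 r1 c2 disX cross.
  apply: (join_placeable p1 p2 r1 c2 disX cross symT disL tP tQ st st' _ _ ltx).
  - by rewrite zt leqW.
  - by rewrite zt' leqW.
  by left.
have disL' : [disjoint QL & x |: Low] by rewrite disjoint_sym.
apply: (join_placeable p1 p2 r1 c2 disX cross symT disL' tQ tP st' st).
- by rewrite zt' leqW.
- by rewrite zt leqW.
- by move=> z /xLP zP; apply: ltLP.
by right.
Qed.

(** Order invariance moves the tree built so far to labels in [J]. Whatever label the neighbour of
    the next leaf gets there, the leaf can be attached with label [y]. *)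
Lemma leaf_tie_tree (J : {set 'I_n}) y X : K <= #|J| -> y \notin J ->
  {in J, forall x, joinable A [set y] J y x} -> leaf_built eT X ->
  exists phi : U -> 'I_n, {in X &, injective phi} /\ supports A X phi.
Proof.
move=> kJ yJ jn; elim=> [r|{}X x w _ [phi [injp sup]] xX wX ew].
  exists (fun=> i0); split; last exact: supports1.
  by move=> u v; rewrite !inE => /eqP-> /eqP->.
have [r rX minr] : exists2 r, r \in X & forall u, u \in X -> phi r <= phi u.
  by case: (arg_minnP (P := mem X) (fun u => phi u) xX) => r rX minr; exists r.
have pl : placeable true X r.
  apply: (placeable_of rX injp _ sup) => u uX nur; rewrite /ltd ltn_neqAle minr // andbT.
  by apply: contra nur => /eqP/val_inj E; apply/eqP/injp.
have [s [ss ms zs]] := enum_ltd true J.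
have [|psi [injs ins _ sups]] := placeableE pl ss.
  by rewrite zs; apply: leq_trans kJ; apply: max_card.
pose phi' u := if u == w then y else psi u.
have E : {in X, phi' =1 psi}.
  by move=> u uX; rewrite /phi'; case: eqP => // uw; rewrite -uw uX in wX.
have inJ : {in X, forall u, phi' u \in J} by move=> u uX; rewrite E // -ms ins.
have wE : phi' w = y by rewrite /phi' eqxx.
exists phi'; split=> [u v|].
  have ny u' : u' \in X -> phi' u' <> y by move=> /inJ + E'; rewrite E' (negPf yJ).
  rewrite !inE => /orP[/eqP->|uX] /orP[/eqP->|vX] //.
  - by rewrite wE => /esym /ny -/(_ vX).
  - by rewrite wE => /ny -/(_ uX).
  by rewrite !E //; apply: injs.
apply: (jn (phi' x) (inJ x xX) [set w] X w x phi'); rewrite ?inE //.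
- by move=> u; rewrite inE => /eqP->; rewrite wE inE.
- by move=> u v; rewrite !inE => /eqP-> /eqP->.
- by move=> u v uX vX; rewrite !E //; apply: injs.
- by move=> u v; rewrite inE => /eqP-> vX; rewrite ew // eqxx.
- exact: supports1.
by rewrite (eq_supports eT eG A (psi := psi)).
Qed.

End Assembly.

(** * Stable blockades *)

Lemma subset_of_card (T : finType) (S : {set T}) k : k <= #|S| ->
  exists S' : {set T}, S' \subset S /\ #|S'| = k.
Proof.
move=> le; exists [set x in take k (enum S)]; split.
  by apply/subsetP=> x; rewrite inE => /mem_take; rewrite mem_enum.
rewrite cardsE (card_uniqP _) ?take_uniq ?enum_uniq // size_take -cardE.
by case: ltngtP le => // ->.
Qed.

Lemma card_ord_interval m a b : b <= m -> #|[set i : 'I_m | a <= i < b]| = b - a.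
Proof.
move=> bm; rewrite cardE size_filter.
rewrite (eq_count (a2 := preim val (fun i => a <= i < b))); last by move=> i; rewrite /= inE.
rewrite -enumT -count_map val_enum_ord -size_filter.
have [ab|/ltnW ba] := leqP a b; last first.
  rewrite (eq_filter (a2 := pred0)) ?filter_pred0 /=; last by move=> i /=; lia.
  by apply/esym/eqP; rewrite subn_eq0.
have -> : iota 0 m = iota 0 a ++ iota a (b - a) ++ iota b (m - b).
  rewrite catA -[X in iota X (b - a)]add0n -iotaD subnKC //.
  by rewrite -[X in iota X (m - b)]add0n -iotaD subnKC.
rewrite size_filter !count_cat.
rewrite (eq_in_count (a2 := pred0)) ?count_pred0; last by move=> i; rewrite mem_iota /=; lia.
rewrite add0n (eq_in_count (a2 := predT)) ?count_predT ?size_iota; last first.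
  by move=> i; rewrite mem_iota /=; lia.
rewrite (eq_in_count (a2 := pred0)) ?count_pred0 ?addn0 //.
by move=> i; rewrite mem_iota /=; lia.
Qed.

Section Stability.
Variables (U V : finType) (eT : rel U) (eG : rel V).
Local Notation supports := (supports eT eG).
Local Notation stable := (stable eT eG).

Lemma stable_comp D w (I J : finType) (A : I -> {set V}) (t : J -> I) :
  injective t -> (forall i, #|A i| = w) -> 0 < D -> stable D w A -> stable D w (A \o t).
Proof.
move=> injt cA D0 stA B subB bigB X phi sup.
(* Blocks outside the image of [t] are kept whole. *)
pose B' i := if [pick j | t j == i] is Some j then B j else A i.
have B't j : B' (t j) = B j.
  by rewrite /B'; case: pickP => [j' /eqP/injt->//|/(_ j)]; rewrite eqxx.
rewrite (eq_supports_blocks eT eG (B := B') (psi := t \o phi)); last by move=> u _; rewrite /= B't.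
apply: stA => [i|i|].
- by rewrite /B'; case: pickP => [j /eqP<-|].
- by rewrite /B'; case: pickP => [j _|_]; [apply: bigB|rewrite cA leq_pmull].
by rewrite (eq_supports_blocks eT eG (B := A \o t) (psi := phi)).
Qed.

(** Each failure of stability shrinks the blocks by a factor [D] and destroys a supported labelling,
    so there are at most [M] rounds. *)
Lemma stabilize D l (I : finType) M (A : I -> {set V}) w : 0 < D ->
  #|[set F : {set U} * {ffun U -> I} | supports A F.1 F.2]| <= M ->
  (forall i, #|A i| = w) -> D ^ M * l <= w ->
  exists (A' : I -> {set V}) w', [/\ forall i, A' i \subset A i, forall i, #|A' i| = w',
    l <= w' & stable D w' A'].
Proof.
move=> D0; elim: M A w => [|M IH] A w few cA big.
  have [stA|nst] := classic (stable D w A).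
    by exists A, w; split=> //; rewrite mul1n in big.
  case: nst => B _ _ X phi sup.
  have : (X, finfun phi) \in [set F : {set U} * {ffun U -> I} | supports A F.1 F.2].
    by rewrite inE (eq_supports eT eG A (psi := phi)) // => u _; rewrite ffunE.
  by move: few; rewrite leqn0 => /eqP/cards0_eq->; rewrite inE.
have [stA|nst] := classic (stable D w A).
  exists A, w; split=> //; apply: leq_trans big.
  by rewrite leq_pmull // expn_gt0 D0.
have [B [X [phi [subB bigB sup nsup]]]] : exists (B : I -> {set V}) (X : {set U}) (phi : U -> I),
    [/\ forall i, B i \subset A i, forall i, w <= D * #|B i|, supports A X phi & ~~ supports B X phi].
  apply: NNPP => no; apply: nst => B subB bigB X phi sup.
  by case E : (supports B X phi) => //; case: no; exists B, X, phi; rewrite E.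
have [B' B'P] : exists B' : I -> {set V}, forall i, B' i \subset B i /\ #|B' i| = w %/ D.
  apply: (fin_all_exists (P := fun i (S : {set V}) => S \subset B i /\ #|S| = w %/ D)) => i.
  by apply: subset_of_card; rewrite -(mulKn #|B i| D0); apply: leq_div2r.
have B'A i : B' i \subset A i := subset_trans (B'P i).1 (subB i).
have [| | |C [w' [CB' cC lw' stC]]] := IH B' (w %/ D).
- rewrite -ltnS; apply: leq_trans few; apply/proper_card/properP; split.
    by apply/subsetP=> F; rewrite !inE; apply: supports_subset.
  have E (A' : I -> {set V}) : supports A' X (finfun phi) = supports A' X phi.
    by apply: eq_supports => u _; rewrite ffunE.
  exists (X, finfun phi); rewrite !inE E //.
  by apply: contra nsup; apply: supports_subset => i; case: (B'P i).
- by move=> i; case: (B'P i).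
- by rewrite leq_divRL // mulnC mulnA -expnS.
by exists C, w'; split=> // i; apply: subset_trans (CB' i) (B'A i).
Qed.

(** The colour of [#|U|] labels records every labelling by positions that they support, so
    homogeneity makes support depend on positions only. *)
Lemma homogeneous_order_invariant N m (A : 'I_N -> {set V}) (i0 : 'I_N) (t : seq 'I_N) (j0 : 'I_m) :
  0 < #|U| -> size t = m + #|U| ->
  homogeneous (fun a => [set F : {set U} * {ffun U -> 'I_#|U|} |
     supports (fun j : 'I_#|U| => A (nth i0 a j)) F.1 F.2]) #|U| t ->
  order_invariant eT eG (fun j : 'I_m => A (nth i0 t j)) j0 true.
Proof.
move=> U0 zt hom X rho s s' lt ss ss' zs zs'.
pose tau (j : 'I_m) := nth i0 t j.
(* Smaller label sets are padded to length [#|U|] with entries of [t] from position [m] on, which is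
   why [t] has [#|U|] extra entries. *)
pose ext (s : seq 'I_m) := map tau s ++ take (#|U| - #|X|) (drop m t).
have ext_sub r : sorted (@ltd m true) r -> subseq (ext r) t.
  move=> sr; rewrite -[X in subseq _ X](cat_take_drop m t) /ext; apply: cat_subseq (take_subseq _ _).
  have -> : map tau r = map (nth i0 t) (map val r) by rewrite -map_comp.
  rewrite -(map_nth_iota0 i0) ?zt ?leq_addr //; apply: map_subseq.
  have sv : sorted ltn (map val r) by rewrite sorted_map.
  have -> : map val r = [seq i <- iota 0 m | i \in map val r].
    apply: (irr_sorted_eq ltn_trans ltnn sv).
      by apply: sorted_filter (iota_ltn_sorted _ _); apply: ltn_trans.
    move=> i; rewrite mem_filter mem_iota /= add0n andbC.
    by case: (boolP (i \in _)) => [/mapP[j _ ->]|]; rewrite ?andbF // ltn_ord.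
  exact: filter_subseq.
have zext r : size r = #|X| -> size (ext r) = #|U|.
  move=> zr; rewrite size_cat size_map zr size_takel ?size_drop ?zt ?addKn ?leq_subr //.
  by rewrite subnKC // max_card.
pose F : {set U} * {ffun U -> 'I_#|U|} := (X, [ffun u => insubd (Ordinal U0) (rho u)]).
have EF r : size r = #|X| -> supports (fun j => A (tau j)) X (fun u => nth j0 r (rho u)) =
    (F \in [set F : {set U} * {ffun U -> 'I_#|U|} |
      supports (fun j : 'I_#|U| => A (nth i0 (ext r) j)) F.1 F.2]).
  move=> zr; rewrite inE; apply: eq_supports_blocks => u uX /=.
  have ltu := lt u uX; rewrite ffunE val_insubd (leq_trans ltu (max_card _)).
  by rewrite nth_cat size_map zr ltu (nth_map j0) ?zr.
rewrite !EF //; move=> FE; rewrite -(hom (ext s) (ext s')) ?ext_sub ?zext //.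
Qed.

End Stability.

(** * The choice of constants and the tree in a stable blockade *)

Section Core.
Variables (U : finType) (eT : rel U).
Hypothesis treeT : is_tree eT.
Let K := #|U|.
Let a := (2 * K).+1.
Let q := 2 * a.
Let p := q.+1 * (2 * K).
(* The labels are split as [QL < P < QR], of sizes [a], [p] and [a]. *)
Definition core_labels := a + p + a.
(** The two lower bounds on [D] that the dichotomy asks for, the first being [8 * c]. *)
Definition core_scale := maxn (8 * (8 * q * K * p).+1)
  (32 * q * #|(({set U} * {set U} * {ffun U -> 'I_core_labels} * (U * U))%type : finType)|).

Lemma tree_in_stable_blockade (V : finType) (eG : rel V) (A : 'I_core_labels -> {set V})
    (j0 : 'I_core_labels) (w mu : nat) :
  simple_graph eG -> (forall i, #|A i| = w) -> (forall i j, i != j -> [disjoint A i & A j]) ->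
  (forall v, #|nbr eG v| <= mu) ->
  (forall X Y : {set V}, [disjoint X & Y] -> mu <= #|X| -> mu <= #|Y| ->
     exists x y, [/\ x \in X, y \in Y & eG x y]) ->
  0 < mu -> core_scale * mu <= w -> stable eT eG core_scale w A ->
  order_invariant eT eG A j0 true ->
  exists phi : U -> 'I_core_labels, injective phi /\ supports eT eG A [set: U] phi.
Proof.
case=> symG irrG cA disA deg dense mu0 bigw stA inv1.
have [[symT irrT] U0 _ _] := treeT.
pose QL := [set i : 'I_core_labels | 0 <= i < a].
pose QR := [set i : 'I_core_labels | a + p <= i < core_labels].
pose P := [set i : 'I_core_labels | a <= i < a + p].
have cQL : #|QL| = a by rewrite card_ord_interval ?subn0 // /core_labels -addnA leq_addr.
have cQR : #|QR| = a by rewrite card_ord_interval // /core_labels addKn.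
have cP : #|P| = p by rewrite card_ord_interval ?addKn // /core_labels leq_addr.
have disLR : [disjoint QL & QR].
  by rewrite -setI_eq0; apply/eqP/setP=> i; rewrite !inE; lia.
have cQ : #|QL :|: QR| = q.
  by rewrite cardsU (disjoint_setI0 disLR) cards0 subn0 cQL cQR /q mul2n addnn.
have disPQ : [disjoint P & QL :|: QR].
  by rewrite -setI_eq0; apply/eqP/setP=> i; rewrite !inE; have := ltn_ord i; lia.
have A0 i : A i != set0.
  rewrite -card_gt0 cA; apply: leq_trans bigw; rewrite muln_gt0 mu0 andbT.
  by rewrite leq_max.
have inv d : order_invariant eT eG A j0 d by case: d => //; apply: order_invariant_rev.
have finish (phi : U -> 'I_core_labels) : {in [set: U] &, injective phi} ->
    supports eT eG A [set: U] phi ->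
    exists phi, injective phi /\ supports eT eG A [set: U] phi.
  by move=> injp sup; exists phi; split=> // u v; apply: injp; rewrite inE.
have build := tree_leaf_built treeT.
have [r rT] := leaf_built_rooted symT build.
have finish_pl d : placeable eT eG A j0 d [set: U] r ->
    exists phi, injective phi /\ supports eT eG A [set: U] phi.
  move=> pl; have [s [ss _ zs]] := enum_ltd d [set: 'I_core_labels].
  have [|phi [injp _ _ sup]] := placeableE pl ss; last exact: finish injp sup.
  rewrite zs !cardsT card_ord /core_labels -addnA /a addSn; apply: leqW.
  by rewrite mul2n -addnn -!addnA leq_addr.
(* With [2 * K] labels in [Low], one side of [x] has at least [K] of them, room for any subtree. *)
have [| | | | | |[J [y [JP kJ yQ jn]]]|[x [Low [y [xP LP kL yQ jn]]]]] :=
    dichotomy symT irrT symG irrG cA disA deg dense stA disPQ (k := 2 * K) _ _ _ mu0 U0.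
- by rewrite cQ.
- by rewrite muln_gt0.
- by rewrite cQ cP.
- by rewrite cQ cP; apply: leq_trans bigw; rewrite leq_mul2r leq_maxl orbT.
- by rewrite cQ cP leq_maxl.
- by rewrite cQ leq_maxr.
- have yJ : y \notin J by apply/negP=> /(subsetP JP); rewrite (disjointFl disPQ yQ).
  have kJ' : #|U| <= #|J| by apply: leq_trans kJ; rewrite leq_pmull.
  have [phi [injp sup]] := leaf_tie_tree irrT irrG A0 inv kJ' yJ jn build.
  exact: finish injp sup.
have close d : grafting eT eG A j0 d (~~ d) /\ grafting eT eG A j0 (~~ d) d ->
    exists phi, injective phi /\ supports eT eG A [set: U] phi.
  case=> g1 g2; apply: (finish_pl d).
  by case: (grafting2_tree irrT irrG A0 inv g1 g2 rT).
have close1 : (exists d, grafting eT eG A j0 d d) ->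
    exists phi, injective phi /\ supports eT eG A [set: U] phi.
  by case=> d g; apply: (finish_pl d); apply: grafting_tree rT.
have [yL|yL] := boolP (y \in QL).
  have [| | | |/close1//|/close//] := graftings inv symT (d := true) disPQ xP LP kL yL _ _ _ _ jn.
  - by rewrite cQL.
  - by rewrite cQR /a leqW // leq_pmull.
  - by move=> i j; rewrite !inE /ltd; lia.
  - by move=> i j; rewrite !inE /ltd; lia.
have yR : y \in QR by move: yQ; rewrite inE (negPf yL).
(* The mirror image: [QR] and [QL] exchange roles and the direction is reversed. *)
rewrite [QL :|: QR]setUC in jn disPQ.
have [| | | |/close1//|/close//] := graftings inv symT (d := false) disPQ xP LP kL yR _ _ _ _ jn.
- by rewrite cQR.
- by rewrite cQL /a leqW // leq_pmull.
- by move=> i j; rewrite !inE /ltd; lia.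
- by move=> i j; rewrite !inE /ltd; lia.
Qed.

End Core.

(** * From real to integer parameters *)

Lemma coherent_nat (R : realFieldType) (V : finType) (eG : rel V) (d W : nat) :
  0 < d -> irreflexive eG -> coherent eG ((W%:R / (d%:R * #|V|%:R))%R : R) ->
  [/\ d <= W, forall v, #|nbr eG v| <= W %/ d &
    forall X Y : {set V}, [disjoint X & Y] -> W < d * #|X| -> W < d * #|Y| ->
      exists x y, [/\ x \in X, y \in Y & eG x y]].
Proof.
move=> d0 irrG [V2 deg coh].
have V0 : (#|V|%:R != 0 :> R)%R by rewrite pnatr_eq0; lia.
have dR : (0 < d%:R :> R)%R by rewrite ltr0n.
have epsV : (W%:R / (d%:R * #|V|%:R) * #|V|%:R = W%:R / d%:R :> R)%R.
  by rewrite invfM mulrA mulfVK.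
rewrite epsV in deg coh.
have {}deg v : #|nbr eG v| * d < W.
  by have := deg v; rewrite ltr_pdivlMr // -natrM ltr_nat.
have dense (X Y : {set V}) : [disjoint X & Y] -> W <= d * #|X| -> W <= d * #|Y| ->
    exists x y, [/\ x \in X, y \in Y & eG x y].
  move=> dis bX bY; apply: NNPP => no; apply: coh; exists X, Y.
  rewrite !ler_pdivrMr // -!natrM !ler_nat !(mulnC _ d); split=> // x y xX yY.
  by apply/negP=> xy; apply: no; exists x, y.
split=> [|v|X Y dis /ltnW bX /ltnW bY]; last exact: dense.
  (* If [W < d], two distinct vertices would be adjacent by density applied to singletons, while
     every degree would be zero. *)
  rewrite leqNgt; apply/negP=> ltW.
  have [x [y [_ _ nxy]]] : exists x y : V, [/\ x \in [set: V], y \in [set: V] & x != y].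
    by apply/card_gt1P; rewrite cardsT.
  have [| | |x' [y' [/set1P-> /set1P-> xy]]] := dense [set x] [set y].
  - by rewrite disjoints1 inE.
  - by rewrite cards1 muln1 ltnW.
  - by rewrite cards1 muln1 ltnW.
  have : 0 < #|nbr eG x| by apply/card_gt0P; exists y; rewrite inE.
  by have := deg x; nia.
by rewrite leq_divRL // ltnW.
Qed.

Unset Implicit Arguments.

Theorem theorem2p1 (R : realFieldType) (U : finType) (eT : rel U) :
  is_tree eT ->
  exists (d : R) (K : nat), (0 < d)%R /\
    forall (V : finType) (eG : rel V), simple_graph eG ->
    forall (n : nat) (B : 'I_n -> {set V}), blockade B -> K <= n ->
    forall W : nat, is_width B W ->
    coherent eG ((W%:R / (d * #|V|%:R))%R) ->
    rainbow_copy eT eG B.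
Proof.
move=> treeT; have [[symT irrT] U0 _ _] := treeT.
pose m := core_labels U; pose D := core_scale U.
have [N ramseyN] := ramsey #|U| {set {set U} * {ffun U -> 'I_#|U|}} (m + #|U|).
pose M := #|[set: {set U} * {ffun U -> 'I_N.+1}]|.
(* [D ^ M] pays for stabilizing and [D] for the width wanted afterwards; the factor 2 absorbs the
   rounding in [mu], as [d <= W]. *)
pose d := 2 * (D ^ M * D).
have D0 : 0 < D by rewrite leq_max.
have d0 : 0 < d by rewrite !muln_gt0 expn_gt0 D0.
exists (d%:R)%R, N.+1; split; first by rewrite ltr0n.
move=> V eG simG n B [B0 disB] Nn W [widB _] /(coherent_nat d0 simG.2)[dW deg dense].
(* The successor turns [mu <= #|X|] into the strict bound [W < d * #|X|]. *)
pose mu := (W %/ d).+1.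
pose emb := widen_ord Nn.
have [A AP] : exists A : 'I_N.+1 -> {set V}, forall i, A i \subset B (emb i) /\ #|A i| = W.
  apply: (fin_all_exists (P := fun i (S : {set V}) => S \subset B (emb i) /\ #|S| = W)) => i.
  exact: subset_of_card (widB _).
have bigW : D ^ M * (D * mu) <= W.
  apply: (@leq_trans (W %/ d * d)); last exact: leq_divM.
  have x0 : 0 < W %/ d by rewrite divn_gt0.
  rewrite mulnA mulnS [leqRHS]mulnCA mul2n -addnn (mulnC (W %/ d)) leq_add2r.
  by rewrite leq_pmulr.
have [|A' [w [A'A cA' bigw stA']]] := stabilize (eT := eT) (eG := eG) (l := D * mu) (M := M) (A := A) D0 _
    (fun i => (AP i).2) bigW.
  by apply: subset_leq_card; apply: subsetT.
have [|t [sub_t zt homt]] := ramseyN _ (fun a => [set F : {set U} * {ffun U -> 'I_#|U|} |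
     supports eT eG (fun j : 'I_#|U| => A' (nth ord0 a j)) F.1 F.2]) (enum 'I_N.+1).
  by rewrite size_enum_ord.
have ut : uniq t := subseq_uniq sub_t (enum_uniq _).
pose tau (j : 'I_m) := nth ord0 t j.
have injtau : injective tau.
  have ltt (i : 'I_m) : i < size t by rewrite zt (leq_trans (ltn_ord i)) ?leq_addr.
  by move=> i j /eqP; rewrite nth_uniq // => /eqP/val_inj.
have disA i j : i != j -> [disjoint A' (tau i) & A' (tau j)].
  move=> nij; have sAB k : A' k \subset B (emb k) := subset_trans (A'A k) (AP k).1.
  apply: disjointW (sAB _) (sAB _) (disB _ _ _).
  by apply: contra nij => /eqP/(congr1 val) /= /val_inj/injtau->.
have m0 : 0 < m by [].
have [||||||||phi [injphi /supportsP[f [fA fE]]]] :=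
    @tree_in_stable_blockade U eT treeT V eG (A' \o tau) (Ordinal m0) w mu simG.
- by move=> i; apply: cA'.
- exact: disA.
- by move=> v; apply: leqW; apply: deg.
- move=> X Y dis bX bY; apply: dense => //.
    by apply: leq_trans (ltn_ceil W d0) _; rewrite mulnC leq_mul2l bX orbT.
  by apply: leq_trans (ltn_ceil W d0) _; rewrite mulnC leq_mul2l bY orbT.
- by [].
- exact: bigw.
- exact: stable_comp.
- exact: homogeneous_order_invariant homt.
have fB x : f x \in B (emb (tau (phi x))).
  by apply: subsetP (subset_trans (A'A _) (AP _).1) _ (fA x _).
have lab x i : f x \in B i -> i = emb (tau (phi x)).
  by move=> xi; apply/eqP/negPn/negP=> /disB dis; have := fB x; rewrite (disjointFr dis xi).
have same x y i : f x \in B i -> f y \in B i -> x = y.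
  move=> /lab-> /lab/(congr1 val) /= /val_inj/injtau; exact: injphi.
exists f; split=> //.
- by move=> x y E; apply: (same x y _ (fB x)); rewrite -E; apply: fB.
- by move=> x y; apply: fE; rewrite inE.
- by move=> x; exists (emb (tau (phi x))).
Qed.
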